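(* Assume the following. (i) The map $(x,\xi)\mapsto\ell(x,\xi)$ is differentiable on $\mathcal{X}\times\Xi$; for any $\xi\in\Xi$ the map $x\mapsto\ell(x,\xi)$ is convex on $\mathcal{X}$ and satisfies $|\ell(x,\xi)|\le B_1$ and $\|\nabla_x\ell(x,\xi)\|\le B_2$ for all $x\in\mathcal{X}$; and for any $x\in\mathcal{X}$ the map $\xi\mapsto\nabla_x\ell(x,\xi)$ is $L_{x\xi}$-Lipschitz on $\Xi$. (ii) The map $(\zeta,\xi)\mapsto c(\zeta,\xi)$ is continuous on $\Xi\times\Xi$. (iii) For any $i\in[n]$ and $(x,\zeta)\in\mathcal{X}\times\Xi$, the map $\xi\mapsto\ell(x,\xi)-\rho_i c(\zeta,\xi)$ is $L_\xi^c$-Lipschitz continuous on $\Xi$. Let $(x_t,\alpha_t)$ be the iterates of the algorithm BiDRO-FL (described in the context) run for $T$ rounds with inner accuracy $\epsilon$, and let $\overline{x}_T:=\frac1T\sum_{t=1}^Tx_t$. Then, selecting $\eta_x=\eta_\alpha=1/\sqrt{T}$ yields $$\mathbb{E}\Big[\sup_{\alpha\in\Delta_{n-1}}F(\overline{x}_T,\alpha)-\inf_{x\in\mathcal{X}}\sup_{\alpha\in\Delta_{n-1}}F(x,\alpha)\Big]=\mathcal{O}\big(T^{-1/2}+\epsilon\big),$$ where the constant in $\mathcal{O}(\cdot)$ does not depend on $T$ or $\epsilon$.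
   Context: Let $[n]=\{1,\dots,n\}$, $\Delta_{n-1}=\{\alpha\in\mathbb{R}^n:\alpha_i\ge0,\ \sum_i\alpha_i=1\}$; let $\Xi\subseteq\mathbb{R}^m$ and $\mathcal{X}\subseteq\mathbb{R}^d$ be convex and compact; $\|\cdot\|$ is the Euclidean norm. The cost function $\ell:\mathbb{R}^d\times\Xi\to\mathbb{R}$ is continuous on $\mathcal{X}\times\Xi$; $c(\zeta,\xi)=\|\zeta-\xi\|^p$ with fixed $p\in[1,\infty)$; $\rho_i>0$ for $i\in[n]$. For each $i\in[n]$, $\widehat{\mathbb{P}}_i=\frac1{N_i}\sum_{k=1}^{N_i}\delta_{\widehat\xi_i^k}$ is the empirical distribution of a fixed dataset $\widehat\xi_i^1,\dots,\widehat\xi_i^{N_i}\in\Xi$. Put $$\phi_i(x,\zeta,\xi):=\ell(x,\xi)-\rho_ic(\zeta,\xi),\quad f_i(x,\zeta):=\sup_{\xi\in\Xi}\phi_i(x,\zeta,\xi),\quad F(x,\alpha):=\sum_{i=1}^n\alpha_i\,\mathbb{E}_{\zeta\sim\widehat{\mathbb{P}}_i}[f_i(x,\zeta)].$$ Algorithm BiDRO-FL, with step sizes $\eta_x,\eta_\alpha>0$, initial points $x_1\in\mathcal{X}$, $\alpha_1\in\Delta_{n-1}$, and inner accuracy $\epsilon\ge0$. At each round $t=1,\dots,T$: each client $i$ draws $\widehat\zeta_{i,t}\sim\widehat{\mathbb{P}}_i$ independently of the sampling history, so that, with $\mathcal{F}_t$ the $\sigma$-algebra generated by the algorithmic history before sampling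 at round $t$ (with respect to which $x_t,\alpha_t$ are measurable), the conditional distribution of $\widehat\zeta_{i,t}$ given $\mathcal{F}_t$ is $\widehat{\mathbb{P}}_i$; client $i$ finds a point $z_{i,t}\in\Xi$ with $\operatorname{dist}(z_{i,t},\mathcal{Z}^\star_{i,t})\le\epsilon$, where $\mathcal{Z}_{i,t}^\star:=\arg\max_{\xi\in\Xi}\phi_i(x_t,\widehat\zeta_{i,t},\xi)$ and $\operatorname{dist}$ is the distance from a point to a set; client $i$ computes $g_{i,t}^x=\nabla_x\ell(x_t,z_{i,t})$, $g_{i,t}^\alpha=\ell(x_t,z_{i,t})-\rho_ic(\widehat\zeta_{i,t},z_{i,t})$ and $x_{i,t+1}=x_t-\eta_xg_{i,t}^x$; the server sets $x_{t+1}=\operatorname{Proj}_{\mathcal{X}}\big(\sum_{i=1}^n\alpha_{i,t}x_{i,t+1}\big)$ and $\alpha_{t+1}=\operatorname{Proj}_{\Delta_{n-1}}(\alpha_t+\eta_\alpha g_t^\alpha)$, where $g_t^\alpha=(g_{1,t}^\alpha,\dots,g_{n,t}^\alpha)$ and $\operatorname{Proj}$ is Euclidean projection. The expectation is over the algorithm's randomness, with the datasets fixed. *)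

(* Defs.v *)
From HB Require Import structures.
From mathcomp Require Import all_boot all_order all_algebra.
From mathcomp Require Import all_classical all_reals all_analysis.
Import Order.TTheory GRing.Theory Num.Theory.
Import numFieldNormedType.Exports.

Set Implicit Arguments.
Unset Strict Implicit.
Unset Printing Implicit Defensive.

Local Open Scope classical_set_scope.
Local Open Scope ring_scope.

Section euclidean.
Context {R : realType}.

(* The library norm `|v| on 'rV_k is the max norm: it is used only for the
   topology and for littleo, where the choice of norm is immaterial. *)
Definition enorm k (v : 'rV[R]_k) : R := Num.sqrt (\sum_j v 0 j ^+ 2).

(* Meaningful for nonempty [A] only (inf set0 = 0). *)
Definition euclid_dist k (v : 'rV[R]_k) (A : set 'rV[R]_k) : R :=
  inf [set enorm (v - w) | w in A].

Definition is_eproj k (A : set 'rV[R]_k) (v p : 'rV[R]_k) : Prop :=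
  A p /\ forall q, A q -> enorm (v - p) <= enorm (v - q).

Definition elipschitz k l (L : R) (A : set 'rV[R]_k)
    (f : 'rV[R]_k -> 'rV[R]_l) : Prop :=
  forall u v, A u -> A v -> enorm (f u - f v) <= L * enorm (u - v).

Definition elipschitz_real k (L : R) (A : set 'rV[R]_k)
    (f : 'rV[R]_k -> R) : Prop :=
  forall u v, A u -> A v -> `|f u - f v| <= L * enorm (u - v).

Definition simplex n : set 'rV[R]_n :=
  [set a | (forall i, 0 <= a 0 i) /\ \sum_i a 0 i = 1].

Definition grad k (f : 'rV[R]_k -> R) (x : 'rV[R]_k) : 'rV[R]_k :=
  \row_j 'D_(delta_mx 0 j) f x.

(* Frechet differentiability at [a] of a function whose domain is [D]; the
   values of [f] off [D] are irrelevant. *)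
Definition differentiable_in (V : normedModType R) (D : set V) (f : V -> R)
    (a : V) : Prop :=
  let F := within D (nbhs a) in
  exists2 df : {linear V -> R}, continuous df &
    (fun v => f v - f a - df (v - a)) =o_F (fun v => v - a).

Definition argmax (V : Type) (A : set V) (f : V -> R) : set V :=
  [set v | A v /\ forall w, A w -> f w <= f v].

Definition borel k : set (set 'rV[R]_k) := <<s [set U | open U] >>.

Definition borel_measurable d (Omega : measurableType d) k
    (Y : Omega -> 'rV[R]_k) : Prop :=
  forall B, borel B -> measurable (Y @^-1` B).

(* (1/N) * sum_j delta_(s_j), as a set function and as an expectation. *)
Definition empirical N V (s : 'I_N -> V) (B : set V) : R :=
  N%:R^-1 * \sum_j \1_B (s j).

Definition empirical_mean N V (s : 'I_N -> V) (g : V -> R) : R :=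
  N%:R^-1 * \sum_j g (s j).

Definition transport_cost k (p : R) (zeta xi : 'rV[R]_k) : R :=
  enorm (zeta - xi) `^ p.

End euclidean.
Arguments simplex {R} n _.
Arguments borel {R} k _.

Section dro.
Context {R : realType} {n m d : nat}.
(* [ell] stands for a function on R^d x Xi. *)
Variables (Xi : set 'rV[R]_m) (X : set 'rV[R]_d).
Variables (ell : 'rV[R]_d -> 'rV[R]_m -> R) (p : R) (rho : 'I_n -> R).
Variables (N : 'I_n -> nat) (data : forall i, 'I_(N i) -> 'rV[R]_m).

Definition phi (i : 'I_n) x zeta xi : R :=
  ell x xi - rho i * transport_cost p zeta xi.

Definition robust_loss (i : 'I_n) x zeta : R :=
  sup [set phi i x zeta xi | xi in Xi].

Definition objective x (alpha : 'rV[R]_n) : R :=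
  \sum_i alpha 0 i * empirical_mean (@data i) (robust_loss i x).

Definition worst_case x : R := sup [set objective x alpha | alpha in simplex n].

Definition gap y : R := worst_case y - inf [set worst_case x | x in X].

Definition grad_x x xi : 'rV[R]_d := grad (ell^~ xi) x.

Section run.
Context {disp : measure_display} {Omega : measurableType disp}.
Variable P : probability Omega R.
Variables (x : nat -> Omega -> 'rV[R]_d) (alpha : nat -> Omega -> 'rV[R]_n).
Variables (zeta z : 'I_n -> nat -> Omega -> 'rV[R]_m).

(* Generated by everything produced before the draws of round [t]: the iterates
   of rounds 1..t and the draws and inner solutions of rounds 1..t-1. *)
Definition history (t : nat) : set (set Omega) :=
  <<s [set A | [\/
    exists s B, [/\ (1 <= s <= t)%N, borel d B & A = x s @^-1` B],
    exists s B, [/\ (1 <= s <= t)%N, borel n B & A = alpha s @^-1` B],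
    exists i s B, [/\ (1 <= s < t)%N, borel m B & A = zeta i s @^-1` B] |
    exists i s B, [/\ (1 <= s < t)%N, borel m B & A = z i s @^-1` B]]] >>.

Definition grad_alpha t w : 'rV[R]_n :=
  \row_i phi i (x t w) (zeta i t w) (z i t w).

Definition local_iterate etax (i : 'I_n) t w : 'rV[R]_d :=
  x t w - etax *: grad_x (x t w) (z i t w).

(* [x], [alpha], [zeta], [z] are random sequences, indexed by rounds from 1,
   produced by [T] rounds of the algorithm. Only the law of each draw given the
   history is prescribed: the draws of different clients in the same round may
   be dependent. *)
Record bidro_fl (T : nat) (etax etaalpha eps : R) (x1 : 'rV[R]_d)
    (alpha1 : 'rV[R]_n) : Prop := BiDROFL {
  run_x1 : forall w, x 1 w = x1 ;
  run_alpha1 : forall w, alpha 1 w = alpha1 ;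
  run_measurable : forall t, (1 <= t <= T)%N ->
    [/\ borel_measurable (x t), borel_measurable (alpha t),
        forall i, borel_measurable (zeta i t) &
        forall i, borel_measurable (z i t)] ;
  run_sampling : forall t, (1 <= t <= T)%N -> forall i A B,
    history t A -> borel m B ->
    (P (A `&` zeta i t @^-1` B) = P A * (empirical (@data i) B)%:E)%E ;
  run_inner : forall t, (1 <= t <= T)%N -> forall i w,
    Xi (z i t w) /\
    euclid_dist (z i t w) (argmax Xi (phi i (x t w) (zeta i t w))) <= eps ;
  run_x : forall t, (1 <= t <= T)%N -> forall w,
    is_eproj X (\sum_i alpha t w 0 i *: local_iterate etax i t w)
      (x t.+1 w) ;
  run_alpha : forall t, (1 <= t <= T)%N -> forall w,
    is_eproj (simplex n) (alpha t w + etaalpha *: grad_alpha t w)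
      (alpha t.+1 w) }.

Definition average_iterate (T : nat) w : 'rV[R]_d :=
  T%:R^-1 *: \sum_(1 <= t < T.+1) x t w.

End run.
End dro.

(* Main.v *)
(* Let f_i(x, z) be the robust loss of client i and F_i(x) its empirical mean.
   By convexity of F(., a), linearity of F(x, .) and the choice of a
   near-minimizer y of sup_a F(., a), the gap at the average iterate is at most
     sup_b 1/T sum_t [F(x_t, b) - F(y, a_t)] + O(1/sqrt T).
   Replacing F_i(x_t) and F_i(y) by their sampled values splits the sum into
   - the regret of projected ascent in a and of projected descent in x, each
     O(sqrt T) + O(T (eps + 1/sqrt T)): the computed gradients are exact up to a
     multiple of the distance from z_(i,t) to a suitable maximizer;
   - sum_t sum_i a_(i,t) n'_(i,t) and - sum_i b_i S_i with S_i = sum_t n_(i,t),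
     where n and n' are the sampling errors at x_t and y, which are martingale
     differences for the history.  The first term has mean zero.  As b may depend
     on the whole run, the second is bounded uniformly in b by
     sum_i |S_i| <= sum_i (S_i^2 / sqrt T + sqrt T) / 2, and E S_i^2 = O(T) by
     orthogonality of the n_(i,t).
   Measurability of the gap is not needed: it is nonnegative and only its upper
   bound is integrated. *)
From HB Require Import structures.
Require Import Defs.
From mathcomp Require Import all_boot all_order all_algebra.
From mathcomp Require Import all_classical all_reals all_analysis.
From mathcomp Require Import measurable_realfun ring lra.
Import Order.TTheory GRing.Theory Num.Theory.
Import numFieldNormedType.Exports.
Local Open Scope classical_set_scope.
Local Open Scope ring_scope.

Set Implicit Arguments.
Unset Strict Implicit.
Unset Printing Implicit Defensive.

(** * Euclidean geometry *)

Section euclidean_geometry.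
Context {R : realType}.

Definition dot k (u v : 'rV[R]_k) : R := \sum_j u 0 j * v 0 j.

Lemma dotC k (u v : 'rV[R]_k) : dot u v = dot v u.
Proof. by apply: eq_bigr => j _; rewrite mulrC. Qed.

Lemma dotDl k (u v w : 'rV[R]_k) : dot (u + v) w = dot u w + dot v w.
Proof. by rewrite -big_split; apply: eq_bigr => j _; rewrite !mxE mulrDl. Qed.

Lemma dotDr k (u v w : 'rV[R]_k) : dot w (u + v) = dot w u + dot w v.
Proof. by rewrite !(dotC w) dotDl. Qed.

Lemma dotZl k a (u w : 'rV[R]_k) : dot (a *: u) w = a * dot u w.
Proof. by rewrite mulr_sumr; apply: eq_bigr => j _; rewrite !mxE mulrA. Qed.

Lemma dotZr k a (u w : 'rV[R]_k) : dot w (a *: u) = a * dot w u.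
Proof. by rewrite !(dotC w) dotZl. Qed.

Lemma dotNl k (u w : 'rV[R]_k) : dot (- u) w = - dot u w.
Proof. by rewrite -scaleN1r dotZl mulN1r. Qed.

Lemma dotNr k (u w : 'rV[R]_k) : dot w (- u) = - dot w u.
Proof. by rewrite !(dotC w) dotNl. Qed.

Lemma dotBl k (u v w : 'rV[R]_k) : dot (u - v) w = dot u w - dot v w.
Proof. by rewrite dotDl dotNl. Qed.

Lemma dotBr k (u v w : 'rV[R]_k) : dot w (u - v) = dot w u - dot w v.
Proof. by rewrite dotDr dotNr. Qed.

Lemma dot0l k (w : 'rV[R]_k) : dot 0 w = 0.
Proof. by rewrite -(scale0r 0) dotZl mul0r. Qed.

Lemma dot_suml k (I : Type) (r : seq I) (u : I -> 'rV[R]_k) w :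
  dot (\sum_(i <- r) u i) w = \sum_(i <- r) dot (u i) w.
Proof.
elim: r => [|i r ih]; first by rewrite !big_nil dot0l.
by rewrite !big_cons dotDl ih.
Qed.

Lemma enorm_ge0 k (u : 'rV[R]_k) : 0 <= enorm u.
Proof. exact: sqrtr_ge0. Qed.

Lemma sqr_enorm k (u : 'rV[R]_k) : enorm u ^+ 2 = dot u u.
Proof.
rewrite sqr_sqrtr; last by apply: sumr_ge0 => j _; exact: sqr_ge0.
by apply: eq_bigr => j _; rewrite expr2.
Qed.

Lemma enormN k (u : 'rV[R]_k) : enorm (- u) = enorm u.
Proof. by congr Num.sqrt; apply: eq_bigr => j _; rewrite mxE sqrrN. Qed.

Lemma enormB k (u v : 'rV[R]_k) : enorm (u - v) = enorm (v - u).
Proof. by rewrite -enormN opprB. Qed.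

Lemma enorm0 k : enorm (0 : 'rV[R]_k) = 0.
Proof. by rewrite /enorm big1 ?sqrtr0// => j _; rewrite mxE expr0n. Qed.

Lemma coord_le_enorm k (u : 'rV[R]_k) j : `|u 0 j| <= enorm u.
Proof.
rewrite -sqrtr_sqr ler_wsqrtr// (bigD1 j)//= lerDl.
by apply: sumr_ge0 => i _; exact: sqr_ge0.
Qed.

(** Cauchy-Schwarz: expand the squared norm of ‖v‖u - ‖u‖v and divide by ‖u‖‖v‖. If one of the norms
    is zero, all coordinates of that vector vanish. *)
Lemma dot_le_enorm k (u v : 'rV[R]_k) : dot u v <= enorm u * enorm v.
Proof.
have [u0|u0] := eqVneq (enorm u) 0.
  rewrite u0 mul0r /dot big1// => j _.
  have := coord_le_enorm u j; rewrite u0 normr_le0 => /eqP ->.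
  by rewrite mul0r.
have [v0|v0] := eqVneq (enorm v) 0.
  rewrite v0 mulr0 /dot big1// => j _.
  have := coord_le_enorm v j; rewrite v0 normr_le0 => /eqP ->.
  by rewrite mulr0.
have ab0 : 0 < enorm u * enorm v by rewrite mulr_gt0// lt0r ?u0 ?v0 enorm_ge0.
rewrite -(ler_pM2l ab0).
have := sqr_ge0 (enorm (enorm v *: u - enorm u *: v)).
rewrite sqr_enorm dotBl !dotBr !dotZl !dotZr -!sqr_enorm (dotC v u).
by nra.
Qed.

Lemma enormD k (u v : 'rV[R]_k) : enorm (u + v) <= enorm u + enorm v.
Proof.
rewrite -(@ler_pXn2r _ 2)// ?nnegrE ?addr_ge0 ?enorm_ge0//.
rewrite sqr_enorm dotDl !dotDr sqrrD -!sqr_enorm (dotC v u).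
have := dot_le_enorm u v; lra.
Qed.

Lemma enormZ k a (u : 'rV[R]_k) : enorm (a *: u) = `|a| * enorm u.
Proof.
apply/eqP; rewrite -(@eqrXn2 _ 2)// ?mulr_ge0 ?enorm_ge0//.
by rewrite exprMn !sqr_enorm dotZl dotZr mulrA -expr2 real_normK ?num_real.
Qed.

Lemma enorm_sum k (I : Type) (r : seq I) (u : I -> 'rV[R]_k) :
  enorm (\sum_(i <- r) u i) <= \sum_(i <- r) enorm (u i).
Proof.
elim: r => [|i r ih]; first by rewrite !big_nil enorm0.
by rewrite !big_cons (le_trans (enormD _ _))// lerD2l.
Qed.

Lemma coord_le_norm k (u : 'rV[R]_k) j : `|u 0 j| <= `|u|.
Proof.
rewrite [leRHS]/Num.norm/= mx_normrE.
exact: (le_bigmax _ (fun ij : 'I_1 * 'I_k => `|u ij.1 ij.2|) (0, j)).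
Qed.

(** Turns max-norm balls, which give the topology, into Euclidean estimates. The factor [k] is
    cruder than its square root but enough for that. *)
Lemma enorm_le_norm k (u : 'rV[R]_k) : enorm u <= k%:R * `|u|.
Proof.
have [k0|k0] := posnP k.
  move: u; rewrite k0 => u.
  by rewrite /enorm big_ord0 sqrtr0 mul0r.
rewrite -[leRHS]ger0_norm ?mulr_ge0// -sqrtr_sqr ler_wsqrtr//.
apply: (@le_trans _ _ (\sum_(j < k) `|u| ^+ 2)).
  apply: ler_sum => j _; rewrite -real_normK ?num_real//.
  by rewrite lerXn2r ?nnegrE// coord_le_norm.
rewrite sumr_const card_ord exprMn -[leLHS]mulr_natl ler_wpM2r// ?sqr_ge0//.
by rewrite -natrX ler_nat -{1}(expn1 k) leq_pexp2l.
Qed.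

Lemma compact_ediam k (A : set 'rV[R]_k) : compact A ->
  exists2 D, 0 <= D & forall u v, A u -> A v -> enorm (u - v) <= D.
Proof.
move=> /compact_bounded [M [_ /(_ (`|M| + 1))]].
have MM : M < `|M| + 1 by rewrite (le_lt_trans (ler_norm _))// ltrDl.
move=> /(_ MM) AM; exists (k%:R * (2 * (`|M| + 1))) => [|u v Au Av].
  by rewrite mulr_ge0// mulr_ge0// addr_ge0.
rewrite (le_trans (enorm_le_norm _))// ler_wpM2l// (le_trans (ler_normB _ _))//.
by rewrite mulr2n mulrDl mul1r lerD//; exact: AM.
Qed.

End euclidean_geometry.

(** * Projected gradient descent *)

Section online_gradient_descent.
Context {R : realType}.

(** Bridges real weights in [0, 1] and the interval-typed weights of [convex_set]. *)
Lemma convex_set_comb k (A : set 'rV[R]_k) (l : R) a b :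
  convex_set A -> A a -> A b -> 0 <= l <= 1 -> A (l *: a + (1 - l) *: b).
Proof.
move=> cA Aa Ab /andP[l0 l1].
have li : Itv.spec (@Itv.num_sem R) (Itv.Real `[0%Z, 1%Z]) l.
  by rewrite /= /Itv.num_sem/= num_real/= in_itv/= l0 l1.
have := cA a b (Itv.mk li) (mem_set Aa) (mem_set Ab).
by move/set_mem.
Qed.

Lemma convex_set_simplex n : convex_set (@simplex R n).
Proof.
move=> a b l /set_mem[a0 a1] /set_mem[b0 b1]; apply/mem_set.
have lE j : (conv l a b : 'rV[R]_n) 0 j =
    l%:num * a 0 j + (1 - l%:num) * b 0 j.
  by rewrite -[LHS]/((l%:num *: (a : 'rV[R]_n)
    + (1 - l%:num) *: (b : 'rV[R]_n)) 0 j) !mxE.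
split=> [i|]; first by rewrite lE addr_ge0// mulr_ge0// subr_ge0.
under eq_bigr do rewrite lE.
by rewrite big_split/= -!mulr_sumr a1 b1 !mulr1 subrKC.
Qed.

(** Induction on the number of points: the new average combines the old one, with weight
    (T+1)/(T+2), and the last point. *)
Lemma convex_set_average k (A : set 'rV[R]_k) (x : nat -> 'rV[R]_k) T :
  convex_set A -> (0 < T)%N -> (forall t, (1 <= t <= T)%N -> A (x t)) ->
  A (T%:R^-1 *: \sum_(1 <= t < T.+1) x t).
Proof.
move=> cA; elim: T => // -[|T] ih _ Ax.
  by rewrite big_nat1 invr1 scale1r; exact: Ax.
rewrite big_nat_recr//= scalerDr.
have := convex_set_comb cA (ih isT _) (Ax T.+2 _)
  (_ : 0 <= (T.+1%:R / T.+2%:R : R) <= 1).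
rewrite scalerA mulrAC divff ?mul1r ?pnatr_eq0//.
rewrite (_ : 1 - _ = T.+2%:R^-1); last first.
  rewrite -[X in X - _](@divff _ T.+2%:R) ?pnatr_eq0// -mulrBl -natrB//.
  by rewrite subSnn mul1r.
apply => //.
- by move=> t /andP[t1 tT]; apply: Ax; rewrite t1 (leq_trans tT).
- by rewrite leqnn.
- by rewrite divr_ge0//= ler_pdivrMr// mul1r ler_nat.
Qed.

(** If the inner product [s] were positive, moving slightly from [p] towards [a] would stay in [A]
    and come closer to [v]. *)
Lemma eproj_obtuse k (A : set 'rV[R]_k) v p a :
  convex_set A -> is_eproj A v p -> A a -> dot (v - p) (a - p) <= 0.
Proof.
move=> cA [Ap pmin] Aa; rewrite leNgt; apply/negP => s0.
set s := dot _ _ in s0; set q := enorm (a - p) ^+ 2.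
have q0 : 0 <= q by exact: sqr_ge0.
have sq0 : 0 < s + q by rewrite ltr_wpDr.
(* This step lies in [0, 1], and l q = s - l s < s, so the squared distance changes by -2 l s + l (l
   q) < 0. *)
pose l := s / (s + q).
have l0 : 0 < l by rewrite divr_gt0.
have l01 : 0 <= l <= 1 by rewrite (ltW l0)/= ler_pdivrMr// mul1r lerDl.
have := pmin _ (convex_set_comb cA Aa Ap l01).
rewrite -(@ler_pXn2r _ 2)// ?nnegrE ?enorm_ge0//.
rewrite (_ : v - (l *: a + (1 - l) *: p) = (v - p) - l *: (a - p)); last first.
  by apply/rowP => j; rewrite !mxE; ring.
move: (v - p) (a - p) @s @q s0 q0 sq0 @l l0 l01 => u w s q s0 q0 sq0 l l0 l01.
rewrite !sqr_enorm dotBl !dotBr !dotZl !dotZr (dotC w u) -!sqr_enorm -/s -/q.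
have -> : q = s / l - s by rewrite /l; field; lra.
have : l * (l * (s / l - s)) = l * s - l * (l * s) by field; lra.
by nra.
Qed.

Lemma eproj_dist k (A : set 'rV[R]_k) v p a :
  convex_set A -> is_eproj A v p -> A a ->
  enorm (p - a) ^+ 2 <= enorm (v - a) ^+ 2.
Proof.
move=> cA pA Aa; have := eproj_obtuse cA pA Aa.
rewrite (_ : v - a = (v - p) - (a - p)); last first.
  by apply/rowP => j; rewrite !mxE; ring.
rewrite -(enormB a) !sqr_enorm.
move: (v - p) (a - p) => u w; rewrite dotBl !dotBr (dotC w u).
have := sqr_ge0 (enorm u); rewrite sqr_enorm; lra.
Qed.

Lemma projected_descent_regret k (A : set 'rV[R]_k) (y g : nat -> 'rV[R]_k)
    eta a T :
  convex_set A -> A a ->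
  (forall t, (1 <= t <= T)%N -> is_eproj A (y t - eta *: g t) (y t.+1)) ->
  2 * eta * \sum_(1 <= t < T.+1) dot (g t) (y t - a) <=
    enorm (y 1 - a) ^+ 2 + eta ^+ 2 * \sum_(1 <= t < T.+1) enorm (g t) ^+ 2.
Proof.
move=> cA Aa yP.
(* Telescoping: the induction carries the current squared distance to [a], which is dropped only at
   the end. *)
suff H s : (s <= T)%N ->
    enorm (y s.+1 - a) ^+ 2
      + 2 * eta * \sum_(1 <= t < s.+1) dot (g t) (y t - a) <=
    enorm (y 1 - a) ^+ 2 + eta ^+ 2 * \sum_(1 <= t < s.+1) enorm (g t) ^+ 2.
  by apply: le_trans (H T (leqnn _)); rewrite lerDr sqr_ge0.
elim: s => [_|s ih sT]; first by rewrite !big_nil !mulr0 !addr0.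
have {ih} := ih (ltnW sT).
rewrite (big_nat_recr s.+1 1)//= (big_nat_recr s.+1 1)//=.
have := eproj_dist cA (yP s.+1 sT) Aa.
rewrite [_ - a in leRHS](_ : _ = (y s.+1 - a) - eta *: g s.+1); last first.
  by apply/rowP => j; rewrite !mxE; ring.
move: (y s.+1 - a) => u.
rewrite [X in _ <= X -> _]sqr_enorm dotBl !dotBr !dotZl !dotZr -!sqr_enorm.
rewrite (dotC u (g s.+1)); lra.
Qed.

(** With step 1/sqrt T, the term eta^2 T G is just G; dividing by 2 eta gives sqrt T (D + G) / 2,
    and the factor 1/2 is given up. *)
Lemma projected_descent_regret_sqrt k (A : set 'rV[R]_k) (y g : nat -> 'rV[R]_k)
    a T D G :
  (0 < T)%N -> convex_set A -> A a ->
  (forall t, (1 <= t <= T)%N ->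
    is_eproj A (y t - (Num.sqrt T%:R)^-1 *: g t) (y t.+1)) ->
  enorm (y 1 - a) ^+ 2 <= D ->
  (forall t, (1 <= t <= T)%N -> enorm (g t) ^+ 2 <= G) ->
  \sum_(1 <= t < T.+1) dot (g t) (y t - a) <= Num.sqrt T%:R * (D + G).
Proof.
move=> T0 cA Aa yP yD gG; have := projected_descent_regret cA Aa yP.
set S := \sum_(1 <= t < T.+1) dot _ _.
set s := Num.sqrt T%:R.
have s0 : 0 < s by rewrite sqrtr_gt0 ltr0n.
have sT : s ^+ 2 = T%:R by rewrite sqr_sqrtr.
have gT : \sum_(1 <= t < T.+1) enorm (g t) ^+ 2 <= s ^+ 2 * G.
  apply: (@le_trans _ _ (\sum_(1 <= t < T.+1) G)).
    by apply: ler_sum_nat => t; rewrite ltnS; exact: gG.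
  by rewrite sumr_const_nat subn1/= sT mulr_natl.
have D0 : 0 <= D by rewrite (le_trans _ yD) ?sqr_ge0.
have G0 : 0 <= G by rewrite (le_trans _ (gG 1 _)) ?sqr_ge0// T0.
move=> H; have {}H : 2 * s^-1 * S <= D + G.
  rewrite (le_trans H)// lerD// exprVn.
  by rewrite ler_pdivrMl// exprn_gt0.
have -> : S = (s * (2 * s^-1 * S)) / 2 by field; lra.
rewrite ler_pdivrMr//.
apply: (@le_trans _ _ (s * (D + G))); first by rewrite ler_pM2l.
by rewrite ler_peMr ?mulr_ge0 ?addr_ge0// ?ltW// ltr1n.
Qed.

End online_gradient_descent.

(** * Subgradients of the cost *)

Section subgradient.
Context {R : realType} {d m : nat}.
Variables (Xi : set 'rV[R]_m) (ell : 'rV[R]_d -> 'rV[R]_m -> R).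

(** The joint differential is restricted to directions (v, 0). The points (x + h v, xi) stay in the
    domain because its first factor is the whole space. *)
Lemma differentiable_in_slice x xi : Xi xi ->
  differentiable_in (setT `*` Xi) (fun u => ell u.1 u.2) (x, xi) ->
  exists2 D : 'rV[R]_d -> R, linear_for *%R D &
    forall v (e : R), 0 < e -> exists2 r : R, 0 < r &
      forall h : R, 0 < `|h| < r ->
        `|ell (x + h *: v) xi - ell x xi - h * D v| <= e * `|h|.
Proof.
move=> Xixi [df _ /eqoP dfo].
exists (fun v => df (v, 0)) => [a u v|v e e0].
  rewrite -[X in df X](_ : a *: (u, 0) + (v, 0) = _) ?linearP//.
  by congr pair => /=; rewrite ?scaler0 ?addr0.
(* Adding 1 keeps the rescaled tolerance and radius well defined when v = 0. *)
have V0 : 0 < `|v| + 1 by rewrite ltr_wpDl.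
have /(dfo _) : 0 < e / (`|v| + 1) by rewrite divr_gt0.
rewrite near_withinE => /nbhs_ballP[r /= r0 rP].
exists (r / (`|v| + 1)) => [|h /andP[h0 hr]]; first by rewrite divr_gt0.
have := rP (x + h *: v, xi).
rewrite [(_, _) - _](_ : _ = (h *: v, 0)); last first.
  by congr pair; rewrite /= ?subrr// addrAC subrr add0r.
have -> : df (h *: v, 0) = h * df (v, 0).
  rewrite -linearZ/=; congr (df _).
  by congr pair; rewrite /= ?scaler0.
move=> /(_ _ _)/le_trans; apply => //.
- split; last exact: ballxx.
  rewrite -ball_normE/= opprD addrA subrr sub0r normrN normrZ.
  rewrite (@le_lt_trans _ _ (`|h| * (`|v| + 1)))//.
    by rewrite ler_wpM2l// lerDl.
  by rewrite -ltr_pdivlMr.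
- rewrite prod_normE/= normr0 normrZ max_l ?mulr_ge0//.
  rewrite [X in X <= _](_ : _ = e * `|h| * (`|v| / (`|v| + 1))); last first.
    by field; lra.
  by rewrite ler_piMr ?mulr_ge0 ?(ltW e0)// ler_pdivrMr// mul1r lerDl.
Qed.

(** [grad_x] is built from derivatives along basis vectors. These are the values of [D] there, and
    linearity determines the rest. *)
Lemma grad_dotE x xi (D : 'rV[R]_d -> R) : linear_for *%R D ->
  (forall v (e : R), 0 < e -> exists2 r : R, 0 < r &
      forall h : R, 0 < `|h| < r ->
        `|ell (x + h *: v) xi - ell x xi - h * D v| <= e * `|h|) ->
  forall v, D v = dot (grad_x ell x xi) v.
Proof.
move=> lD DP v.
have DZ a u : D (a *: u) = a * D u.
  have D0 : D 0 = 0.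
    by have := lD 1 0 0; rewrite scale1r addr0 mul1r; lra.
  by have := lD a u 0; rewrite D0 !addr0.
have DD u w : D (u + w) = D u + D w by have := lD 1 u w; rewrite scale1r mul1r.
have -> : D v = \sum_j v 0 j * D (delta_mx 0 j).
  rewrite {1}(row_sum_delta v).
  elim: (index_enum _) => [|j r ih].
    by rewrite !big_nil -(scale0r 0) DZ mul0r.
  by rewrite !big_cons DD ih DZ.
apply: eq_bigr => j _; rewrite mulrC; congr (_ * _).
rewrite /grad_x /grad mxE; apply/esym; rewrite /derive; apply: cvg_lim => //.
apply/cvgrPdist_le => e e0.
have [r r0 rP] := DP (delta_mx 0 j) e e0.
exists r => //= h /=; rewrite sub0r normrN => hr h0.
have hp : 0 < `|h| by rewrite normr_gt0.
have := rP h; rewrite hr hp => /(_ isT) H.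
rewrite -(ler_pM2r hp) -normrM mulrBl distrC [h *: _ + x]addrC.
by rewrite -[_ *: _ * h]/(h^-1 * _ * h) mulrAC mulVf// mul1r [D _ * h]mulrC.
Qed.

(** Convexity bounds the increment from x to x + h (y - x) by h times the full increment; divide by
    h and compare with the differential, up to [e]. *)
Lemma convex_subgradient (X : set 'rV[R]_d) x y xi :
  convex_set X -> X x -> X y -> Xi xi ->
  convex_function X (fun x => ell x xi) ->
  differentiable_in (setT `*` Xi) (fun u => ell u.1 u.2) (x, xi) ->
  dot (grad_x ell x xi) (y - x) <= ell y xi - ell x xi.
Proof.
move=> cX Xx Xy Xixi cell /(differentiable_in_slice Xixi)[D lD DP].
rewrite -(grad_dotE lD DP).
apply/ler_addgt0Pr => e e0.
(* The bound 1 keeps the point on the segment from [x] to [y]; r / 2 keeps it within reach of the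
   differential estimate. *)
have [r r0 /(_ (Num.min 1 (r / 2)))] := DP (y - x) e e0.
set h := Num.min _ _.
have h0 : 0 < h by rewrite lt_min ltr01 divr_gt0.
have h1 : h <= 1 by rewrite ge_min lexx.
rewrite gtr0_norm// h0 (@le_lt_trans _ _ (r / 2)); last 2 first.
  by rewrite ge_min lexx orbT.
  by rewrite ltr_pdivrMr// ltr_pMr// ltr1n.
move=> /(_ isT) H.
have li : Itv.spec (@Itv.num_sem R) (Itv.Real `[0%Z, 1%Z]) h.
  by rewrite /= /Itv.num_sem/= num_real/= in_itv/= (ltW h0) h1.
have := cell (Itv.mk li) y x (mem_set Xy) (mem_set Xx).
rewrite [X in ell X](_ : _ = x + h *: (y - x)); last first.
  rewrite -[LHS]/(h *: (y : 'rV_d) + (1 - h) *: (x : 'rV_d)).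
  by apply/rowP => j; rewrite !mxE; ring.
rewrite -[X in _ <= X]/(h * ell y xi + (1 - h) * ell x xi) => cv.
rewrite -(ler_pM2l h0).
by move: H; rewrite ler_norml => /andP[H1 H2]; lra.
Qed.

End subgradient.

(** * Bounded random variables and sampling noise *)

Section bounded_measurable.
Context {R : realType} {disp : measure_display} {T : measurableType disp}.

(** Makes integrability automatic and is stable under the operations used below. Measurability for
    the history is expressed by reading [f] on the same set with the generated sigma-algebra. *)
Definition bounded_measurable (f : T -> R) :=
  measurable_fun setT f /\ exists M, forall w, `|f w| <= M.

Lemma bounded_measurable_cst c : bounded_measurable (fun=> c).
Proof. by split; [exact: measurable_cst|exists `|c|]. Qed.

Lemma bounded_measurableD f g : bounded_measurable f -> bounded_measurable g ->
  bounded_measurable (fun w => f w + g w).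
Proof.
move=> [mf [M fM]] [mg [K gK]]; split; first exact: measurable_funD.
by exists (M + K) => w; rewrite (le_trans (ler_normD _ _))// lerD.
Qed.

Lemma bounded_measurableM f g : bounded_measurable f -> bounded_measurable g ->
  bounded_measurable (fun w => f w * g w).
Proof.
move=> [mf [M fM]] [mg [K gK]]; split; first exact: measurable_funM.
by exists (M * K) => w; rewrite normrM ler_pM.
Qed.

Lemma bounded_measurableB f g : bounded_measurable f -> bounded_measurable g ->
  bounded_measurable (fun w => f w - g w).
Proof.
move=> bf bg; rewrite (_ : (fun _ => _) = (fun w => f w + -1 * g w)).
  by apply: bounded_measurableD => //; apply: bounded_measurableM => //;
    exact: bounded_measurable_cst.
by apply/funext => w; rewrite mulN1r.
Qed.

Lemma bounded_measurable_sum (I : Type) (r : seq I) (Q : pred I)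
    (f : I -> T -> R) :
  (forall i, Q i -> bounded_measurable (f i)) ->
  bounded_measurable (fun w => \sum_(i <- r | Q i) f i w).
Proof.
move=> bf; elim: r => [|i r ih].
  rewrite (_ : (fun _ => _) = (fun=> 0)); first exact: bounded_measurable_cst.
  by apply/funext => w; rewrite big_nil.
have [Qi|Qi] := boolP (Q i).
  rewrite (_ : (fun _ => _) = (fun w => f i w + \sum_(j <- r | Q j) f j w)).
    by apply: bounded_measurableD => //; exact: bf.
  by apply/funext => w; rewrite big_cons Qi.
rewrite (_ : (fun _ => _) = (fun w => \sum_(j <- r | Q j) f j w))//.
by apply/funext => w; rewrite big_cons (negbTE Qi).
Qed.

Lemma bounded_measurable_indic (D : set T) :
  measurable D -> bounded_measurable (\1_D : T -> R).
Proof.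
move=> mD; split; first exact: measurable_indic.
by exists 1 => w; rewrite indicE ger0_norm// lern1 leq_b1.
Qed.

Variable P : probability T R.

Lemma bounded_measurable_integrable f :
  bounded_measurable f -> P.-integrable setT (EFin \o f).
Proof.
move=> [mf [M fM]]; apply: measurable_bounded_integrable => //.
  by rewrite -ge0_fin_numE ?fin_num_measure.
exists M; split; first exact: num_real.
by move=> K MK w _ /=; rewrite (le_trans (fM w))// ltW.
Qed.

Definition mean (f : T -> R) : R := \int[P]_w f w.

Lemma expectation_bounded f : bounded_measurable f -> ('E_P[f] = (mean f)%:E)%E.
Proof.
move=> bf; rewrite unlock /mean /Rintegral fineK//.
by apply: integrable_fin_num => //; exact: bounded_measurable_integrable.
Qed.

Lemma meanD f g : bounded_measurable f -> bounded_measurable g ->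
  mean (fun w => f w + g w) = mean f + mean g.
Proof.
move=> bf bg.
by apply: RintegralD => //; exact: bounded_measurable_integrable.
Qed.

Lemma meanZ c f : bounded_measurable f -> mean (fun w => c * f w) = c * mean f.
Proof.
by move=> bf; apply: RintegralZl => //; exact: bounded_measurable_integrable.
Qed.

Lemma meanB f g : bounded_measurable f -> bounded_measurable g ->
  mean (fun w => f w - g w) = mean f - mean g.
Proof.
move=> bf bg.
by apply: RintegralB => //; exact: bounded_measurable_integrable.
Qed.

Lemma mean_cst c : mean (fun=> c) = c.
Proof.
rewrite /mean Rintegral_cst// [X in fine X](_ : _ = 1%E) ?mulr1//.
exact: probability_setT.
Qed.

Lemma le_mean f g : bounded_measurable f -> bounded_measurable g ->
  (forall w, f w <= g w) -> mean f <= mean g.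
Proof.
move=> bf bg fg.
by apply: le_Rintegral => //; exact: bounded_measurable_integrable.
Qed.

Lemma mean_sum (I : Type) (r : seq I) (Q : pred I) (f : I -> T -> R) :
  (forall i, Q i -> bounded_measurable (f i)) ->
  mean (fun w => \sum_(i <- r | Q i) f i w) = \sum_(i <- r | Q i) mean (f i).
Proof.
move=> bf; elim: r => [|i r ih].
  rewrite big_nil -[RHS](mean_cst 0); congr mean.
  by apply/funext => w; rewrite big_nil.
have [Qi|Qi] := boolP (Q i).
  rewrite big_cons Qi -ih -meanD; [|exact: bf|exact: bounded_measurable_sum].
  by congr mean; apply/funext => w; rewrite big_cons Qi.
rewrite big_cons (negbTE Qi) -ih.
by congr mean; apply/funext => w; rewrite big_cons (negbTE Qi).
Qed.

Lemma mean_indic (D : set T) : measurable D -> mean \1_D = fine (P D).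
Proof. by move=> mD; rewrite /mean /Rintegral integral_indic// setIT. Qed.

(** Here [f] need not be measurable: the integral of a nonnegative function is a supremum over
    simple functions below it, and those below [f] are below [g]. *)
Lemma expectation_le_bounded f g : (forall w, 0 <= f w <= g w) ->
  bounded_measurable g -> (0 <= 'E_P[f] <= (mean g)%:E)%E.
Proof.
move=> fg bg; rewrite -expectation_bounded//.
have f0 w : (0 <= (f w)%:E)%E by rewrite lee_fin; have /andP[] := fg w.
have g0 w : (0 <= (g w)%:E)%E.
  by rewrite lee_fin; have /andP[f0' fg'] := fg w; exact: le_trans fg'.
rewrite unlock; apply/andP; split; first by apply: integral_ge0 => w _ /=.
rewrite !ge0_integralTE//; apply: le_ereal_sup => _ [h hf <-].
exists h => // w; rewrite (le_trans (hf w))// lee_fin.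
by have /andP[] := fg w.
Qed.

End bounded_measurable.

(** * Events independent of a sub-sigma-algebra *)

Section independent_event.
Context {R : realType} {disp : measure_display} {T : measurableType disp}.
Variables (P : probability T R) (S : set (set T)).
Hypothesis S_measurable : S `<=` measurable.

Lemma bounded_measurable_sub (f : T -> R) :
  bounded_measurable (f : g_sigma_algebraType S -> R) -> bounded_measurable f.
Proof.
move=> [mf bf]; split => // _ B mB.
have := mf measurableT B mB; rewrite setTI.
by apply: (smallest_sub _ S_measurable); exact: sigma_algebra_measurable.
Qed.

(** On the open half-line, the law of f 1_D is c times the law of f, and the mean of a nonnegative
    variable depends only on that part of its law. *)
Lemma ge0_mean_indicM (D : set T) (c : R) (f : T -> R) :
  measurable D -> 0 <= c ->
  (forall A, <<s S >> A -> P (A `&` D) = (P A * c%:E)%E) ->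
  bounded_measurable (f : g_sigma_algebraType S -> R) -> (forall w, 0 < f w) ->
  mean P (fun w => f w * \1_D w) = c * mean P f.
Proof.
move=> mD c0 PD bf f0.
have bf' := bounded_measurable_sub bf.
have bY : bounded_measurable (fun w => f w * \1_D w).
  by apply: bounded_measurableM => //; exact: bounded_measurable_indic.
pose Ym := isMeasurableFun.Build _ _ _ _ _ bY.1.
pose Y : {mfun T >-> R} := HB.pack (fun w => f w * \1_D w) Ym.
pose fm := isMeasurableFun.Build _ _ _ _ _ bf'.1.
pose F : {mfun T >-> R} := HB.pack f fm.
have posE (g : {mfun T >-> R}) : (forall w, 0 <= g w) ->
    (\int[P]_w (g w)%:E = \int[pushforward P g]_(y in `]0%R, +oo[) y%:E)%E.
  move=> g0; rewrite ge0_integral_pushforward//=.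
  - rewrite [RHS]integral_mkcond; apply: eq_integral => w _.
    rewrite patchE; case: ifPn => // /negP; rewrite inE/= in_itv/= andbT => gw.
    by have := g0 w; rewrite le_eqVlt => /predU1P[<-|].
  by move=> y; rewrite inE/= in_itv/= andbT lee_fin => /ltW.
rewrite /mean /Rintegral (posE Y); last first.
  by move=> w; rewrite /Y/= mulr_ge0 ?(ltW (f0 w))// indicE.
rewrite (posE F); last by move=> w; exact: ltW.
rewrite (@eq_measure_integral _ _ _ _ (mscale (NngNum c0) (pushforward P F))).
  rewrite ge0_integral_mscale//=.
  - rewrite -(posE F); last by move=> w; exact: ltW.
    rewrite fineM//; apply: integrable_fin_num => //.
    exact: (@bounded_measurable_integrable _ _ _ P f).
  by move=> y; rewrite in_itv/= andbT lee_fin => /ltW.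
(* As [A] lies in the positive half-line, f 1_D falls in [A] exactly on the intersection of [D] with
   the event that f does. *)
move=> A mA A0; rewrite -[LHS]/(P (Y @^-1` A)) -[RHS]/(c%:E * P (f @^-1` A))%E.
rewrite muleC -PD; last first.
  by have := bf.1 measurableT A mA; rewrite setTI.
congr (P _); apply/seteqP; split=> w /=.
  rewrite indicE; case: (boolP (w \in D)) => wD.
    by rewrite mulr1 => ?; split=> //; exact: set_mem.
  by rewrite mulr0 => /A0/=; rewrite in_itv/= ltxx.
by move=> [Aw Dw]; rewrite indicE mem_set// mulr1.
Qed.

(** Shift [f] by a constant to make it positive. The shift contributes K P(D) = K c on both sides
    and cancels; P(D) = c comes from taking A to be the whole space. *)
Lemma mean_indicM (D : set T) (c : R) (f : T -> R) :
  measurable D -> 0 <= c ->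
  (forall A, <<s S >> A -> P (A `&` D) = (P A * c%:E)%E) ->
  bounded_measurable (f : g_sigma_algebraType S -> R) ->
  mean P (fun w => f w * \1_D w) = c * mean P f.
Proof.
move=> mD c0 PD bf; have [M fM] := bf.2.
have [K fK] : exists K, forall w, 0 < f w + K.
  exists (`|M| + 1) => w; have := fM w; rewrite ler_norml => /andP[+ _].
  by have := ler_norm M; lra.
have bK : bounded_measurable (fun w => (f w + K) : R).
  apply: bounded_measurableD; last exact: bounded_measurable_cst.
  exact: bounded_measurable_sub.
have bD : bounded_measurable (\1_D : T -> R) by exact: bounded_measurable_indic.
have bf' := bounded_measurable_sub bf.
have := @ge0_mean_indicM D c (fun w => f w + K) mD c0 PD.
rewrite (_ : (fun w => (f w + K) * \1_D w) =
    (fun w => f w * \1_D w + K * \1_D w)); last first.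
  by apply/funext => w; rewrite mulrDl.
rewrite !meanD//; last 3 first.
- exact: bounded_measurableM.
- by apply: bounded_measurableM => //; exact: bounded_measurable_cst.
- exact: bounded_measurable_cst.
rewrite meanZ// mean_cst mean_indic//.
have -> : P D = c%:E.
  have := PD setT (@measurableT _ (g_sigma_algebraType S)); rewrite setTI => ->.
  by rewrite -[RHS]mul1e; congr (_ * _)%E; exact: probability_setT.
rewrite /= mulrDr (mulrC K c) => H; apply: (addIr (c * K)); apply: H => //.
apply: (@bounded_measurableD _ _ (g_sigma_algebraType S)) => //.
exact: bounded_measurable_cst.
Qed.

End independent_event.

Lemma borel_closed {R : realType} k (A : set 'rV[R]_k) : closed A -> borel k A.
Proof.
move=> cA; rewrite -(setCK A); apply: sigma_algebraC.
by apply: sub_sigma_algebra => /=; exact: closed_openC.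
Qed.

Lemma borel_set1 {R : realType} k (v : 'rV[R]_k) : borel k [set v].
Proof.
apply: borel_closed; apply: accessible_closed_set1.
exact/hausdorff_accessible/norm_hausdorff.
Qed.

(** * Sampling error of one draw from a finite dataset *)

Section sampling_noise.
Context {R : realType} {m K : nat} {U : Type}.
Variables (data : 'I_K -> 'rV[R]_m) (Z : U -> 'rV[R]_m).

Let mult k : R := \sum_j (data j == data k)%:R.

Let mult_gt0 k : 0 < mult k.
Proof. by rewrite /mult (bigD1 k)//= eqxx ltr_wpDr// sumr_ge0. Qed.

(* Dividing by the multiplicity of [data k] makes the sum equal to the value
   of [h] at the sampled point even if the data has repetitions. *)
Definition sampled (h : 'I_K -> U -> R) w : R :=
  \sum_k (mult k)^-1 * (h k w * \1_(Z @^-1` [set data k]) w).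

(** The value [h k] at the k-th data point may itself be random, such as the loss at the current
    iterate. Expanding over the finite dataset separates it from the draw, which enters only through
    indicators. *)
Definition noise h w : R := sampled h w - K%:R^-1 * \sum_k h k w.

Lemma empirical_set1 k : empirical data [set data k] = K%:R^-1 * mult k.
Proof.
congr (_ * _); apply: eq_bigr => j _; rewrite indicE; congr (nat_of_bool _)%:R.
by apply/idP/eqP => [|/eqP/eqP jk]; [rewrite inE|rewrite inE].
Qed.

Lemma sampledE h w k0 : (forall j k, data j = data k -> h j w = h k w) ->
  Z w = data k0 -> sampled h w = h k0 w.
Proof.
move=> hP Zk0.
transitivity (\sum_k (data k == data k0)%:R * ((mult k0)^-1 * h k0 w)).
  apply: eq_bigr => k _; rewrite indicE.
  have [kk0|kk0] := eqVneq (data k) (data k0).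
    rewrite mem_set/=; last by rewrite Zk0.
    by rewrite mulr1 mul1r (hP _ _ kk0) /mult kk0.
  rewrite memNset/= ?mul0r ?mulr0// Zk0 => /esym.
  exact/eqP.
by rewrite -mulr_suml -/(mult k0) mulrA divff ?mul1r// gt_eqF.
Qed.

Lemma noiseE h f w : (forall k, h k w = f (data k)) -> range data (Z w) ->
  noise h w = f (Z w) - empirical_mean data f.
Proof.
move=> hf [k _ kw]; rewrite /noise (@sampledE h w k)//; last first.
  by move=> i j ij; rewrite !hf ij.
rewrite hf kw; congr (_ - _ * _); exact: eq_bigr.
Qed.

(** A factor known before the draw is absorbed into [h], so that zero mean of every noise yields
    orthogonality to such factors. *)
Lemma noiseM g h w : g w * noise h w = noise (fun k w => g w * h k w) w.
Proof.
rewrite /noise mulrBr mulrCA !mulr_sumr; congr (_ - _).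
  by apply: eq_bigr => k _; rewrite mulrCA !mulrA.
Qed.

End sampling_noise.

Section sampling_noise_mean.
Context {R : realType} {m K : nat} {disp : measure_display}
  {T : measurableType disp}.
Variables (data : 'I_K -> 'rV[R]_m) (Z : T -> 'rV[R]_m).

Lemma bounded_measurable_noise h :
  (forall B, borel m B -> measurable (Z @^-1` B)) ->
  (forall k, bounded_measurable (h k)) -> bounded_measurable (noise data Z h).
Proof.
move=> mZ bh; apply: bounded_measurableB.
  apply: bounded_measurable_sum => k _; apply: bounded_measurableM.
    exact: bounded_measurable_cst.
  apply: bounded_measurableM => //; apply: bounded_measurable_indic.
  by apply: mZ; exact: borel_set1.
apply: bounded_measurableM; first exact: bounded_measurable_cst.
by apply: bounded_measurable_sum => k _.
Qed.

Variables (P : probability T R) (S : set (set T)).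
Hypothesis S_measurable : S `<=` measurable.
Hypothesis K_gt0 : (0 < K)%N.
Hypothesis Z_measurable : borel_measurable Z.
Hypothesis Z_sampling : forall A B, <<s S >> A -> borel m B ->
  (P (A `&` Z @^-1` B) = P A * (empirical data B)%:E)%E.

(** Given the history, the draw hits the value [data k] with probability multiplicity / K; the
    weight in [sampled] cancels the multiplicity. *)
Lemma mean_noise (h : 'I_K -> T -> R) :
  (forall k, bounded_measurable (h k : g_sigma_algebraType S -> R)) ->
  mean P (noise data Z h) = 0.
Proof.
move=> bh; have bh' k := bounded_measurable_sub S_measurable (bh k).
have bD k : bounded_measurable (\1_(Z @^-1` [set data k]) : T -> R).
  by apply: bounded_measurable_indic; apply: Z_measurable; exact: borel_set1.
rewrite meanB; last 2 first.
- apply: bounded_measurable_sum => k _.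
  apply: bounded_measurableM; first exact: bounded_measurable_cst.
  exact: bounded_measurableM.
- apply: bounded_measurableM; first exact: bounded_measurable_cst.
  by apply: bounded_measurable_sum => k _.
rewrite meanZ; last by apply: bounded_measurable_sum => k _.
rewrite mean_sum ?mean_sum//; last first.
  move=> k _; apply: bounded_measurableM; first exact: bounded_measurable_cst.
  exact: bounded_measurableM.
apply/eqP; rewrite subr_eq0; apply/eqP; rewrite mulr_sumr.
apply: eq_bigr => k _; rewrite meanZ; last exact: bounded_measurableM.
have m0 : 0 < \sum_j (data j == data k)%:R :> R.
  by rewrite (bigD1 k)//= eqxx ltr_wpDr// sumr_ge0.
rewrite (@mean_indicM _ _ _ _ S _ _ (empirical data [set data k]))//.
- rewrite empirical_set1 -mulrA [LHS]mulrCA; congr (_ * _).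
  by rewrite mulrA mulVf ?mul1r// gt_eqF.
- by apply: Z_measurable; exact: borel_set1.
- by rewrite empirical_set1 mulr_ge0 ?invr_ge0// ltW.
- by move=> A SA; apply: Z_sampling => //; exact: borel_set1.
Qed.

(** The sampling law is applied with the whole space as history event; the complement of the finite
    dataset has empirical mass 0. *)
Lemma data_ae : P (Z @^-1` (~` range data)) = 0%E.
Proof.
have bR : borel m (~` range data).
  apply: sigma_algebraC; apply: borel_closed.
  apply: compact_closed; first exact: norm_hausdorff.
  by apply: finite_compact; exact: finite_image.
have := @Z_sampling setT _ (@measurableT _ (g_sigma_algebraType S)) bR.
rewrite setTI => ->; rewrite /empirical big1 ?mulr0 ?mule0// => j _.
by rewrite indicE memNset//=; apply; exists j.
Qed.

End sampling_noise_mean.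

(** Since [f] is controlled on [X] only, its superlevel sets are intersected with [X]; these are
    closed, so their preimages under [Y] are measurable. *)
Lemma bounded_measurable_lipschitz_comp {R : realType} {k : nat}
    {disp : measure_display} {T : measurableType disp} (X : set 'rV[R]_k)
    (Y : T -> 'rV[R]_k) (f : 'rV[R]_k -> R) (L M : R) :
  closed X -> (forall w, X (Y w)) ->
  (forall u v, X u -> X v -> `|f u - f v| <= L * enorm (u - v)) ->
  (forall w, `|f (Y w)| <= M) ->
  (forall B, borel k B -> measurable (Y @^-1` B)) ->
  bounded_measurable (fun w => f (Y w)).
Proof.
move=> cX XY fL fM mY; split; last by exists M.
move=> _; apply: (measurability _ (RGenCInfty.measurableE R)) => //.
move=> /= _ [_ [a ->] <-]; rewrite setTI.
rewrite (_ : _ @^-1` _ = Y @^-1` (X `&` [set x | a <= f x])); last first.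
  apply/seteqP; split => w /=; rewrite in_itv/= andbT; first by split.
  by case.
apply: mY; apply: borel_closed => v /= vA.
have Xv : X v.
  by apply: cX => B /vA[u [[Xu _] Bu]]; exists u.
split => //=; rewrite leNgt; apply/negP => fa.
have L0 : 0 < `|L| * k%:R + 1 by rewrite ltr_wpDl// mulr_ge0.
(* Within this max-norm radius, [f] varies on [X] by less than a - f v, so no point of the
   superlevel set can be that close to [v]. *)
pose r := (a - f v) / (`|L| * k%:R + 1).
have r0 : 0 < r by rewrite divr_gt0// subr_gt0.
have [u [[Xu /= au]]] := vA _ (nbhsx_ballx v r r0).
rewrite -ball_normE/= /r ltr_pdivlMr// => ur.
suff : `|f u - f v| < a - f v.
  by rewrite ltr_norml => /andP[_]; rewrite ltrD2r ltNge au.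
apply: le_lt_trans ur; rewrite (le_trans (fL _ _ Xu Xv))//.
apply: (@le_trans _ _ (`|L| * (k%:R * `|v - u|))).
  apply: (@le_trans _ _ (`|L| * enorm (u - v))).
    by rewrite ler_wpM2r ?enorm_ge0 ?ler_norm.
  by rewrite ler_wpM2l// distrC enorm_le_norm.
by rewrite mulrA mulrC ler_wpM2l// lerDl.
Qed.

Lemma bounded_measurable_sum_nat {R : realType} {disp : measure_display}
    {T : measurableType disp} a b (f : nat -> T -> R) :
  (forall t, (a <= t < b)%N -> bounded_measurable (f t)) ->
  bounded_measurable (fun w => \sum_(a <= t < b) f t w).
Proof.
move=> bf; rewrite (_ : (fun _ => _) =
    (fun w => \sum_(a <= t < b | (a <= t < b)%N) f t w)).
  exact: bounded_measurable_sum.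
by apply/funext => w; rewrite big_nat.
Qed.

Lemma mean_sum_nat {R : realType} {disp : measure_display}
    {T : measurableType disp} (P : probability T R) a b (f : nat -> T -> R) :
  (forall t, (a <= t < b)%N -> bounded_measurable (f t)) ->
  mean P (fun w => \sum_(a <= t < b) f t w) = \sum_(a <= t < b) mean P (f t).
Proof.
move=> bf; rewrite [RHS]big_nat -mean_sum//.
by congr mean; apply/funext => w; rewrite big_nat.
Qed.

Lemma noise_bounded {R : realType} {m K : nat} {U : Type}
    (data : 'I_K -> 'rV[R]_m) (Z : U -> 'rV[R]_m) (h : 'I_K -> U -> R) (c : R) w :
  (0 < K)%N -> (forall j k, data j = data k -> h j w = h k w) ->
  (forall k, `|h k w| <= c) -> `|noise data Z h w| <= 2 * c.
Proof.
move=> K0 hP hc; have K0' : (0 : R) < K%:R by rewrite ltr0n.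
have c0 : 0 <= c by rewrite (le_trans _ (hc (Ordinal K0))).
rewrite (le_trans (ler_normB _ _))// mulr2n mulrDl mul1r lerD//.
  have [[k _ kw]|nk] := pselect (range data (Z w)).
    by rewrite (@sampledE _ _ _ _ data Z h w k).
  (* Off the dataset all indicators vanish and [sampled] is 0. *)
  rewrite /sampled big1 ?normr0// => k _.
  rewrite indicE memNset/= ?mulr0// => zk; apply: nk; exists k => //.
rewrite normrM gtr0_norm ?invr_gt0// ler_pdivrMl//.
rewrite (le_trans (ler_norm_sum _ _ _))//.
rewrite mulr_natl -[X in _ *+ X](card_ord K) -sumr_const.
by apply: ler_sum => k _.
Qed.

(** * The robust objective *)

(** The slack [e] replaces attainment of the infimum; it is later taken to be 1/sqrt T, which the
    rate absorbs. *)
Lemma euclid_dist_approx {R : realType} k (v : 'rV[R]_k) A eps e :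
  A !=set0 -> 0 < e -> euclid_dist v A <= eps ->
  exists2 w, A w & enorm (v - w) <= eps + e.
Proof.
move=> [a Aa] e0 vA.
have hA : has_inf [set enorm (v - w) | w in A].
  split; first by exists (enorm (v - a)), a.
  by exists 0 => _ [w _ <-]; exact: enorm_ge0.
have [_ [w Aw <-] wlt] := inf_adherent e0 hA.
by exists w => //; rewrite (le_trans (ltW wlt))// lerD2r.
Qed.

Section robust_objective.
Context {R : realType} {n m d : nat}.
Variables (Xi : set 'rV[R]_m) (X : set 'rV[R]_d).
Variables (ell : 'rV[R]_d -> 'rV[R]_m -> R) (p : R) (rho : 'I_n -> R).
Variables (N : 'I_n -> nat) (data : forall i, 'I_(N i) -> 'rV[R]_m).
Variables (B1 B2 Lxxi Lcxi DXi DX : R).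
Hypotheses (Xi_compact : compact Xi) (X_convex : convex_set X).
Hypotheses (p_ge1 : 1 <= p) (N_gt0 : forall i, (0 < N i)%N).
Hypothesis data_Xi : forall (i : 'I_n) (k : 'I_(N i)), Xi (data k).
Hypothesis ell_differentiable : forall x xi, X x -> Xi xi ->
  differentiable_in (setT `*` Xi) (fun u => ell u.1 u.2) (x, xi).
Hypothesis ell_convex :
  forall xi, Xi xi -> convex_function X (fun x => ell x xi).
Hypothesis ell_bounded : forall x xi, X x -> Xi xi -> `|ell x xi| <= B1.
Hypothesis grad_bounded :
  forall x xi, X x -> Xi xi -> enorm (grad_x ell x xi) <= B2.
Hypothesis grad_lipschitz : forall x, X x -> elipschitz Lxxi Xi (grad_x ell x).
Hypothesis phi_lipschitz : forall i x zeta, X x -> Xi zeta ->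
  elipschitz_real Lcxi Xi (phi ell p rho i x zeta).
Hypothesis Xi_diam : forall u v, Xi u -> Xi v -> enorm (u - v) <= DXi.
Hypothesis X_diam : forall u v, X u -> X v -> enorm (u - v) <= DX.

Let phi := phi ell p rho.
Let loss := robust_loss Xi ell p rho.
Let B := B1 + `|Lcxi| * DXi.

Definition client_loss i x := empirical_mean (@data i) (loss i x).

Lemma ell_subgradient x y xi : X x -> X y -> Xi xi ->
  dot (grad_x ell x xi) (y - x) <= ell y xi - ell x xi.
Proof.
move=> Xx Xy Xixi; apply: (@convex_subgradient _ _ _ Xi _ X) => //.
- exact: ell_convex.
- exact: ell_differentiable.
Qed.

(** Compare [xi] with [zeta], where the cost vanishes because 0^p = 0, and use the Lipschitz bound
    over the diameter. The constant [Lcxi] carries no sign assumption, hence its absolute value. *)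
Lemma phi_bounded i x zeta xi : X x -> Xi zeta -> Xi xi ->
  `|phi i x zeta xi| <= B.
Proof.
move=> Xx Xz Xixi; rewrite -[phi i x zeta xi](subrK (phi i x zeta zeta)) addrC.
rewrite (le_trans (ler_normD _ _))// lerD//.
  rewrite /phi /Defs.phi /transport_cost subrr enorm0 powR0 ?mulr0 ?subr0.
    exact: ell_bounded.
  by rewrite gt_eqF// (lt_le_trans _ p_ge1).
rewrite (le_trans (phi_lipschitz i Xx Xz Xixi Xz))//.
apply: (@le_trans _ _ (`|Lcxi| * enorm (xi - zeta))).
  by rewrite ler_wpM2r ?enorm_ge0 ?ler_norm.
by rewrite ler_wpM2l// Xi_diam.
Qed.

(** Extreme value theorem on the compact [Xi]; the Lipschitz bound gives continuity. *)
Lemma argmax_phi_neq0 i x zeta : X x -> Xi zeta ->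
  argmax Xi (phi i x zeta) !=set0.
Proof.
move=> Xx Xz.
have [||v /set_mem Xv vP] := @EVT_max_rV R m (phi i x zeta) Xi _ Xi_compact.
- by exists zeta.
- apply/subspace_continuousP => u Xu; apply/cvgrPdist_le => e e0.
  rewrite near_withinE.
  have L0 : 0 < `|Lcxi| * m%:R + 1 by rewrite ltr_wpDl// mulr_ge0.
  apply/nbhs_ballP; exists (e / (`|Lcxi| * m%:R + 1)).
    by rewrite /= divr_gt0.
  move=> w; rewrite -ball_normE/= => uw Xw.
  rewrite (le_trans (phi_lipschitz i Xx Xz Xu Xw))//.
  rewrite (@le_trans _ _ (`|Lcxi| * (m%:R * `|u - w|)))//.
    apply: (@le_trans _ _ (`|Lcxi| * enorm (u - w))).
      by rewrite ler_wpM2r ?enorm_ge0 ?ler_norm.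
    by rewrite ler_wpM2l// enorm_le_norm.
  rewrite mulrA (@le_trans _ _ ((`|Lcxi| * m%:R + 1) * `|u - w|))//.
    by rewrite ler_wpM2r// lerDl.
  by rewrite mulrC -ler_pdivlMr// ltW.
- by exists v; split=> [|w Xw]; [exact: Xv|apply/vP/mem_set/Xw].
Qed.

Lemma robust_loss_argmax i x zeta v : argmax Xi (phi i x zeta) v ->
  loss i x zeta = phi i x zeta v.
Proof.
move=> [Xv vmax]; apply/eqP; rewrite eq_le; apply/andP; split.
  by apply: ge_sup => [|_ [w Xw <-]]; [exists (phi i x zeta v), v|exact: vmax].
apply: ub_le_sup; last by exists v.
by exists (phi i x zeta v) => _ [w Xw <-]; exact: vmax.
Qed.

Lemma phi_le_robust_loss i x zeta xi : X x -> Xi zeta -> Xi xi ->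
  phi i x zeta xi <= loss i x zeta.
Proof.
move=> Xx Xz Xixi; have [v vP] := argmax_phi_neq0 i Xx Xz.
by rewrite (robust_loss_argmax vP); apply: vP.2.
Qed.

Lemma robust_loss_bounded i x zeta : X x -> Xi zeta -> `|loss i x zeta| <= B.
Proof.
move=> Xx Xz; have [v vP] := argmax_phi_neq0 i Xx Xz.
by rewrite (robust_loss_argmax vP); apply: phi_bounded => //; exact: vP.1.
Qed.

(** Danskin's argument: a maximizer [v] at [x] is a competitor at [y], the cost terms cancel, and
    the gradient of [ell] at [v] is a subgradient of the robust loss. *)
Lemma robust_loss_sub_le i x y zeta v : X x -> X y -> Xi zeta ->
  argmax Xi (phi i x zeta) v ->
  loss i x zeta - loss i y zeta <= dot (grad_x ell x v) (x - y).
Proof.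
move=> Xx Xy Xz vP; rewrite (robust_loss_argmax vP).
have := phi_le_robust_loss i Xy Xz vP.1.
have := ell_subgradient Xx Xy vP.1.
rewrite -(opprB x) dotNr /phi /Defs.phi; lra.
Qed.

Lemma robust_loss_lipschitz i x y zeta : X x -> X y -> Xi zeta ->
  `|loss i x zeta - loss i y zeta| <= B2 * enorm (x - y).
Proof.
move=> Xx Xy Xz.
wlog : x y Xx Xy / loss i y zeta <= loss i x zeta => [wlg|yx].
  have [/wlg|/ltW/wlg] := leP (loss i y zeta) (loss i x zeta); first exact.
  by rewrite distrC enormB; exact.
rewrite ger0_norm ?subr_ge0//.
have [v vP] := argmax_phi_neq0 i Xx Xz.
rewrite (le_trans (robust_loss_sub_le Xx Xy Xz vP))//.
rewrite (le_trans (dot_le_enorm _ _))// ler_wpM2r ?enorm_ge0//.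
exact: grad_bounded vP.1.
Qed.

(** Jensen's inequality through the subgradient at the average. *)
Lemma robust_loss_average i (x : nat -> 'rV[R]_d) T zeta : (0 < T)%N ->
  (forall t, (1 <= t <= T)%N -> X (x t)) -> Xi zeta ->
  loss i (T%:R^-1 *: \sum_(1 <= t < T.+1) x t) zeta <=
  T%:R^-1 * \sum_(1 <= t < T.+1) loss i (x t) zeta.
Proof.
move=> T0 Xx Xz; set y := _ *: _.
have Xy : X y by exact: convex_set_average.
have [v vP] := argmax_phi_neq0 i Xy Xz.
have T0' : (0 : R) < T%:R by rewrite ltr0n.
rewrite ler_pdivlMl// (robust_loss_argmax vP).
(* Deviations from the average sum to zero, so the linear terms disappear. *)
have S0 : \sum_(1 <= t < T.+1) dot (grad_x ell y v) (x t - y) = 0.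
  under eq_bigr do rewrite dotC dotBl.
  rewrite big_split/= -dot_suml sumr_const_nat subn1/= -[_ *+ _]mulr_natl.
  rewrite /y dotZl mulrN mulrA divff ?mul1r ?subrr//.
  by rewrite gt_eqF.
rewrite -[leLHS]addr0 -[X in _ + X <= _]S0.
rewrite (_ : T%:R * _ = \sum_(1 <= t < T.+1) phi i y zeta v); last first.
  by rewrite sumr_const_nat subn1/= mulr_natl.
rewrite -big_split/=. apply: ler_sum_nat => t; rewrite ltnS => tT.
have := ell_subgradient Xy (Xx t tT) vP.1.
have := phi_le_robust_loss i (Xx t tT) Xz vP.1.
by rewrite /phi /Defs.phi; lra.
Qed.

Lemma empirical_mean_le i (f g : 'rV[R]_m -> R) :
  (forall k, f (data (i:=i) k) <= g (data k)) ->
  empirical_mean (@data i) f <= empirical_mean (@data i) g.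
Proof.
by move=> fg; rewrite ler_wpM2l ?invr_ge0// ler_sum.
Qed.

Lemma empirical_mean_cst i (c : R) : empirical_mean (@data i) (fun=> c) = c.
Proof.
rewrite /empirical_mean sumr_const card_ord -[c *+ _]mulr_natl mulrA.
rewrite mulVf ?mul1r//.
by rewrite pnatr_eq0 -lt0n N_gt0.
Qed.

Lemma client_loss_bounded i x : X x -> `|client_loss i x| <= B.
Proof.
move=> Xx; have H (k : 'I_(N i)) : - B <= loss i x (data k) <= B.
  by rewrite -ler_norml; exact: robust_loss_bounded.
rewrite ler_norml -{1}(empirical_mean_cst i (- B)) -{2}(empirical_mean_cst i B).
by apply/andP; split; apply: empirical_mean_le => k; have /andP[] := H k.
Qed.

Lemma client_loss_average i (x : nat -> 'rV[R]_d) T : (0 < T)%N ->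
  (forall t, (1 <= t <= T)%N -> X (x t)) ->
  client_loss i (T%:R^-1 *: \sum_(1 <= t < T.+1) x t) <=
  T%:R^-1 * \sum_(1 <= t < T.+1) client_loss i (x t).
Proof.
move=> T0 Xx.
apply: (@le_trans _ _ (empirical_mean (@data i)
    (fun u => T%:R^-1 * \sum_(1 <= t < T.+1) loss i (x t) u))).
  by apply: empirical_mean_le => k; exact: robust_loss_average.
rewrite /empirical_mean -!mulr_sumr mulrCA ler_wpM2l ?invr_ge0//.
by rewrite ler_wpM2l ?invr_ge0// exchange_big.
Qed.

Let worst := worst_case Xi ell p rho data.
Let obj := objective Xi ell p rho data.

Lemma objectiveE x a : obj x a = \sum_i a 0 i * client_loss i x.
Proof. by []. Qed.

Lemma objective_le x a c : simplex n a ->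
  (forall i, client_loss i x <= c) -> obj x a <= c.
Proof.
move=> [a0 a1] xc; rewrite -[leRHS]mul1r -[X in X * c]a1 mulr_suml.
apply: ler_sum => i _.
by apply: ler_wpM2l; [exact: a0|exact: xc].
Qed.

Lemma objective_le_worst_case x a : X x -> simplex n a -> obj x a <= worst x.
Proof.
move=> Xx sa; apply: ub_le_sup; last by exists a.
exists B => _ [b sb <-]; apply: objective_le => // i.
by rewrite (le_trans (ler_norm _))// client_loss_bounded.
Qed.

Lemma worst_case_le x c : (0 < n)%N ->
  (forall a, simplex n a -> obj x a <= c) -> worst x <= c.
Proof.
move=> n0 xc; apply: ge_sup => [|_ [a sa <-]]; last exact: xc.
(* A vertex of the simplex shows that the supremum is over a nonempty set. *)
exists (obj x (delta_mx 0 (Ordinal n0))), (delta_mx 0 (Ordinal n0)) => //.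
split=> [i|]; first by rewrite mxE.
rewrite (bigD1 (Ordinal n0))//= mxE !eqxx big1 ?addr0// => i ni.
by rewrite mxE (negbTE ni) andbF.
Qed.

Lemma worst_case_bounded x : (0 < n)%N -> X x -> `|worst x| <= B.
Proof.
move=> n0 Xx; have i0 := Ordinal n0.
have bnd i : - B <= client_loss i x <= B.
  by rewrite -ler_norml client_loss_bounded.
rewrite ler_norml; apply/andP; split; last first.
  apply: worst_case_le => // a sa; apply: objective_le => // i.
  by have /andP[] := bnd i.
pose a := delta_mx 0 i0 : 'rV[R]_n.
have sa : simplex n a.
  split=> [i|]; first by rewrite mxE.
  rewrite (bigD1 i0)//= mxE !eqxx big1 ?addr0// => i ni.
  by rewrite mxE (negbTE ni) andbF.
rewrite (le_trans _ (objective_le_worst_case Xx sa))//.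
rewrite objectiveE (bigD1 i0)//= mxE !eqxx mul1r big1 ?addr0 => [|i ni].
  by have /andP[] := bnd i0.
by rewrite mxE (negbTE ni) andbF mul0r.
Qed.

Lemma inf_worst_case x : (0 < n)%N -> X x -> has_inf [set worst x | x in X].
Proof.
move=> n0 Xx; split; first by exists (worst x), x.
exists (- B) => _ [y Xy <-].
by have := worst_case_bounded n0 Xy; rewrite ler_norml => /andP[].
Qed.

Let gp := gap Xi X ell p rho data.

Lemma gap_ge0 x : (0 < n)%N -> X x -> 0 <= gp x.
Proof.
move=> n0 Xx; rewrite subr_ge0; apply: ge_inf; last by exists x.
by have [] := inf_worst_case n0 Xx.
Qed.

(** A crude bound for the null event on which some draw leaves its dataset. *)
Lemma gap_le_bound x : (0 < n)%N -> X x -> gp x <= 2 * B.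
Proof.
move=> n0 Xx; have := worst_case_bounded n0 Xx; rewrite ler_norml => /andP[_ H].
have : - B <= inf [set worst x | x in X].
  apply: lb_le_inf; first by exists (worst x), x.
  move=> _ [y Xy <-].
  by have := worst_case_bounded n0 Xy; rewrite ler_norml => /andP[].
by rewrite /gp /gap -/worst; lra.
Qed.

Lemma gap_near_minimizer e : (0 < n)%N -> X !=set0 -> 0 < e ->
  exists2 y, X y & forall x, gp x <= worst x - worst y + e.
Proof.
move=> n0 [x0 Xx0] e0.
have [_ [y Xy <-] yi] := inf_adherent e0 (inf_worst_case n0 Xx0).
by exists y => // x; rewrite /gp /gap -/worst; lra.
Qed.

Lemma argmax_approx i x zeta z eps e : X x -> Xi zeta -> 0 < e ->
  euclid_dist z (argmax Xi (phi i x zeta)) <= eps ->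
  exists2 v, argmax Xi (phi i x zeta) v & enorm (z - v) <= eps + e.
Proof.
by move=> Xx Xz e0; apply: euclid_dist_approx => //; exact: argmax_phi_neq0.
Qed.

Lemma robust_loss_approx i x zeta z r v : X x -> Xi zeta -> Xi z ->
  argmax Xi (phi i x zeta) v -> enorm (z - v) <= r ->
  `|loss i x zeta - phi i x zeta z| <= `|Lcxi| * r.
Proof.
move=> Xx Xz Xzz vP zr; rewrite (robust_loss_argmax vP) distrC.
rewrite (le_trans (phi_lipschitz i Xx Xz Xzz vP.1))//.
apply: (@le_trans _ _ (`|Lcxi| * enorm (z - v))).
  by rewrite ler_wpM2r ?enorm_ge0 ?ler_norm.
by rewrite ler_wpM2l.
Qed.

(** Passing from the gradient at the exact maximizer to the computed one costs, by Cauchy-Schwarz,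
    the gradient error times the diameter of [X]. *)
Lemma robust_loss_sub_le_approx i x y zeta z r v : X x -> X y -> Xi zeta ->
  Xi z -> argmax Xi (phi i x zeta) v -> enorm (z - v) <= r ->
  loss i x zeta - loss i y zeta <=
  dot (grad_x ell x z) (x - y) + `|Lxxi| * r * DX.
Proof.
move=> Xx Xy Xz Xzz vP zr.
rewrite (le_trans (robust_loss_sub_le Xx Xy Xz vP))//.
rewrite -lerBlDl -dotBl (le_trans (dot_le_enorm _ _))//.
apply: ler_pM; rewrite ?enorm_ge0 ?X_diam//.
rewrite (le_trans (grad_lipschitz Xx vP.1 Xzz))//.
apply: (@le_trans _ _ (`|Lxxi| * enorm (v - z))).
  by rewrite ler_wpM2r ?enorm_ge0 ?ler_norm.
by rewrite ler_wpM2l// enormB.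
Qed.

(** * Deterministic analysis of a single trajectory *)

Section trajectory.
Variables (T : nat) (eps : R) (x : nat -> 'rV[R]_d) (a : nat -> 'rV[R]_n).
Variables (zeta z : 'I_n -> nat -> 'rV[R]_m).
Let s : R := Num.sqrt T%:R.
Hypothesis T_gt0 : (0 < T)%N.
Hypothesis xX : forall t, (1 <= t <= T)%N -> X (x t).
Hypothesis a_simplex : forall t, (1 <= t <= T)%N -> simplex n (a t).
Hypothesis zeta_Xi : forall i t, (1 <= t <= T)%N -> Xi (zeta i t).
Hypothesis z_Xi : forall i t, (1 <= t <= T)%N -> Xi (z i t).
Hypothesis z_inner : forall i t, (1 <= t <= T)%N ->
  euclid_dist (z i t) (argmax Xi (phi i (x t) (zeta i t))) <= eps.
Hypothesis x_step : forall t, (1 <= t <= T)%N ->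
  is_eproj X (\sum_i a t 0 i *: (x t - s^-1 *: grad_x ell (x t) (z i t)))
    (x t.+1).
Hypothesis a_step : forall t, (1 <= t <= T)%N ->
  is_eproj (simplex n)
    (a t + s^-1 *: \row_i phi i (x t) (zeta i t) (z i t)) (a t.+1).

Let s_gt0 : 0 < s. Proof. by rewrite sqrtr_gt0 ltr0n. Qed.

(** Distance within which each inner solution has an exact maximizer, the second term being the
    slack of [argmax_approx]. *)
Let r := eps + s^-1.

Let simplex01 (b : 'rV[R]_n) i : simplex n b -> 0 <= b 0 i <= 1.
Proof.
move=> [b0 b1]; rewrite b0/= -[leRHS]b1 (bigD1 i)//= lerDl.
by rewrite sumr_ge0.
Qed.

Let sqr_enorm_le (u : 'rV[R]_n) c : (forall i, `|u 0 i| <= c) ->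
  enorm u ^+ 2 <= n%:R * c ^+ 2.
Proof.
move=> uc; rewrite sqr_enorm mulr_natl -[X in _ *+ X](card_ord n) -sumr_const.
apply: ler_sum => i _; rewrite -expr2 -real_normK ?num_real//.
by rewrite lerXn2r ?nnegrE// (le_trans _ (uc i)).
Qed.

(** Ascent on the weights is projected descent with the negated payoffs. Replacing payoffs by exact
    robust losses costs at most |Lcxi| r per client and round. *)
Lemma adversary_regret b : simplex n b ->
  \sum_(1 <= t < T.+1) \sum_i (b 0 i - a t 0 i) * loss i (x t) (zeta i t) <=
  s * (n%:R + n%:R * B ^+ 2) + T%:R * (n%:R * (`|Lcxi| * r)).
Proof.
move=> sb.
pose g t := - \row_i phi i (x t) (zeta i t) (z i t).
have gr : \sum_(1 <= t < T.+1) dot (g t) (a t - b) <= s * (n%:R + n%:R * B ^+ 2).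
  apply: (@projected_descent_regret_sqrt _ _ (simplex n)) => //.
  - exact: convex_set_simplex.
  - by move=> t tT; rewrite scalerN opprK; exact: a_step.
  (* Coordinates of a difference of two simplex points lie in [-1, 1], so the squared diameter is at
     most n. *)
  - rewrite -[leRHS]mulr1 -[X in _ <= _ * X](expr1n _ 2).
    apply: sqr_enorm_le => i; rewrite !mxE.
    have /andP[? ?] := simplex01 i sb.
    have /andP[? ?] := simplex01 i (@a_simplex 1 T_gt0).
    by rewrite ler_norml; lra.
  - move=> t tT; rewrite enormN; apply: sqr_enorm_le => i.
    by rewrite mxE; apply: phi_bounded; [exact: xX|exact: zeta_Xi|exact: z_Xi].
rewrite [X in _ <= _ + X](_ : _ =
  \sum_(1 <= t < T.+1) n%:R * (`|Lcxi| * r)); last first.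
  by rewrite sumr_const_nat subn1/= [LHS]mulr_natl.
rewrite -lerBlDr (le_trans _ gr)// -sumrB; apply: ler_sum_nat => t.
rewrite ltnS => tT; rewrite lerBlDr.
rewrite [X in _ + X]mulr_natl -[X in _ *+ X](card_ord n) -sumr_const -big_split/=.
apply: ler_sum => i _; rewrite /g !mxE.
have [|||| v vP zv] := @argmax_approx i (x t) (zeta i t) (z i t) eps s^-1.
- exact: xX.
- exact: zeta_Xi.
- by rewrite invr_gt0.
- exact: z_inner.
have := robust_loss_approx (xX tT) (zeta_Xi i tT) (z_Xi i tT) vP zv.
have /andP[? ?] := simplex01 i sb.
have /andP[? ?] := simplex01 i (a_simplex tT).
rewrite -/r; set l := loss _ _ _; set q := phi _ _ _ _ => lq.
have : `|(b 0 i - a t 0 i) * (l - q)| <= `|Lcxi| * r.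
  rewrite normrM -[leRHS]mul1r ler_pM//.
  by rewrite ler_norml; lra.
by rewrite ler_norml => /andP[_]; lra.
Qed.

(** The weights sum to 1, so averaging the local iterates amounts to one gradient step along the
    weighted gradient [g], whose norm is at most [B2]. *)
Lemma learner_regret y : X y ->
  \sum_(1 <= t < T.+1) \sum_i a t 0 i *
    (loss i (x t) (zeta i t) - loss i y (zeta i t)) <=
  s * (DX ^+ 2 + B2 ^+ 2) + T%:R * (`|Lxxi| * r * DX).
Proof.
move=> Xy.
pose g t := \sum_i a t 0 i *: grad_x ell (x t) (z i t).
have gr : \sum_(1 <= t < T.+1) dot (g t) (x t - y) <= s * (DX ^+ 2 + B2 ^+ 2).
  apply: (@projected_descent_regret_sqrt _ _ X) => //.
  - move=> t tT; have := x_step tT.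
    rewrite (_ : \sum_i _ = x t - s^-1 *: g t)//.
    under eq_bigr do rewrite scalerBr.
    rewrite sumrB -scaler_suml (a_simplex tT).2 scale1r; congr (_ - _).
    rewrite /g scaler_sumr; apply: eq_bigr => i _.
    by rewrite !scalerA mulrC.
  - have D0 : 0 <= DX by rewrite -(@enorm0 R d) -(subrr y) X_diam.
    by rewrite lerXn2r ?nnegrE ?enorm_ge0// X_diam//; exact: xX.
  - move=> t tT.
    have gB : enorm (g t) <= B2.
      rewrite (le_trans (enorm_sum _ _))// -[leRHS]mul1r.
      rewrite -[X in _ <= X * _](a_simplex tT).2 mulr_suml.
      apply: ler_sum => i _; rewrite enormZ ger0_norm ?(a_simplex tT).1//.
      rewrite ler_wpM2l ?(a_simplex tT).1//.
      by apply: grad_bounded; [exact: xX|exact: z_Xi].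
    by rewrite lerXn2r ?nnegrE ?enorm_ge0// (le_trans _ gB)// enorm_ge0.
rewrite [X in _ <= _ + X](_ : _ =
  \sum_(1 <= t < T.+1) `|Lxxi| * r * DX); last first.
  by rewrite sumr_const_nat subn1/= [LHS]mulr_natl.
rewrite -lerBlDr (le_trans _ gr)// -sumrB; apply: ler_sum_nat => t.
rewrite ltnS => tT; rewrite lerBlDr /g dot_suml.
rewrite -[X in _ + X]mul1r -[X in _ + X * _](a_simplex tT).2 mulr_suml.
rewrite -big_split/=; apply: ler_sum => i _.
rewrite dotZl -mulrDr ler_wpM2l ?(a_simplex tT).1//.
have [|||| v vP zv] := @argmax_approx i (x t) (zeta i t) (z i t) eps s^-1.
- exact: xX.
- exact: zeta_Xi.
- by rewrite invr_gt0.
- exact: z_inner.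
exact: (robust_loss_sub_le_approx (xX tT) Xy (zeta_Xi i tT) (z_Xi i tT) vP zv).
Qed.

Let noise_x i t := loss i (x t) (zeta i t) - client_loss i (x t).
Let noise_y y i t := loss i y (zeta i t) - client_loss i y.

(** The supremum over [b] is removed pathwise: what remains random is a square of noise sums and a
    noise weighted by the iterates, both with computable means. *)
Lemma gap_average_le y : (0 < n)%N -> X y ->
  (forall u, gp u <= worst u - worst y + s^-1) ->
  gp (T%:R^-1 *: \sum_(1 <= t < T.+1) x t) <=
  s^-1 + T%:R^-1 * (
    s * (n%:R + n%:R * B ^+ 2 + (DX ^+ 2 + B2 ^+ 2)) +
    T%:R * (n%:R * (`|Lcxi| * r) + `|Lxxi| * r * DX) +
    (\sum_i 2^-1 * (s^-1 * (\sum_(1 <= t < T.+1) noise_x i t) ^+ 2 + s) +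
     \sum_(1 <= t < T.+1) \sum_i a t 0 i * noise_y y i t)).
Proof.
move=> n0 Xy gy; set xb := _ *: _.
have Xxb : X xb by exact: convex_set_average.
rewrite (le_trans (gy xb))// [leRHS]addrC lerD2r lerBlDr.
have T0 : (0 : R) < T%:R by rewrite ltr0n.
apply: worst_case_le => // b sb.
have wy : T%:R^-1 * \sum_(1 <= t < T.+1) obj y (a t) <= worst y.
  rewrite ler_pdivrMl// mulr_natl.
  rewrite (_ : worst y *+ T = \sum_(1 <= t < T.+1) worst y); last first.
    by rewrite sumr_const_nat subn1.
  apply: ler_sum_nat => t; rewrite ltnS => tT.
  by apply: objective_le_worst_case => //; exact: a_simplex.
apply: (@le_trans _ _ (T%:R^-1 * \sum_(1 <= t < T.+1) obj (x t) b)).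
  rewrite (eq_bigr _ (fun t _ => objectiveE (x t) b)) exchange_big/= objectiveE.
  rewrite mulr_sumr; apply: ler_sum => i _.
  rewrite -mulr_sumr [leRHS]mulrCA ler_wpM2l ?sb.1//.
  exact: client_loss_average.
apply: le_trans (lerD (lexx _) wy).
rewrite -lerBlDr -mulrBr ler_pM2l ?invr_gt0// -sumrB.
have := lerD (adversary_regret sb) (learner_regret Xy).
rewrite -big_split/=.
(* Since b_i lies in [0, 1], each term is at most |S|, and |S| <= (S^2 / s + s) / 2 from (s - |S|)^2
   >= 0; the bound is free of [b]. *)
have nb : \sum_i - b 0 i * (\sum_(1 <= t < T.+1) noise_x i t) <=
    \sum_i 2^-1 * (s^-1 * (\sum_(1 <= t < T.+1) noise_x i t) ^+ 2 + s).
  apply: ler_sum => i _; set S := \sum_(_ <= _ < _) _.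
  have /andP[b0 b1] := simplex01 i sb.
  have := sqr_ge0 (s + S); have := sqr_ge0 (s - S); have si := s_gt0.
  have -> : s^-1 * S ^+ 2 + s = (S ^+ 2 + s ^+ 2) / s by field; lra.
  rewrite mulrA ler_pdivlMr// => h1 h2.
  have : `|S| * s <= 2^-1 * (S ^+ 2 + s ^+ 2).
    by have [S0|S0] := leP 0 S; [rewrite ger0_norm//|rewrite ltr0_norm//]; lra.
  apply: le_trans; rewrite ler_pM2r//.
  rewrite (le_trans (ler_norm _))// normrM normrN (ger0_norm b0)//.
  by rewrite ler_piMl.
move: nb; set nbl := \sum_i - _ * _; move=> nb rg.
have nblE : nbl = \sum_(1 <= t < T.+1) \sum_i - b 0 i * noise_x i t.
  by rewrite exchange_big/=; apply: eq_bigr => i _; rewrite mulr_sumr.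
(* Write each client loss as its sampled value minus its noise, then insert a_i times the sampled
   loss at x_t to form the two regrets. *)
rewrite (_ : \sum_(1 <= t < T.+1) (obj (x t) b - obj y (a t)) =
  \sum_(1 <= t < T.+1) (\sum_i (b 0 i - a t 0 i) * loss i (x t) (zeta i t) +
    \sum_i a t 0 i * (loss i (x t) (zeta i t) - loss i y (zeta i t))) +
  (nbl + \sum_(1 <= t < T.+1) \sum_i a t 0 i * noise_y y i t)).
  lra.
rewrite nblE -!big_split/=; apply: eq_bigr => t _.
rewrite !objectiveE -sumrB -!big_split/=; apply: eq_bigr => i _.
by rewrite /noise_x /noise_y; ring.
Qed.

End trajectory.

End robust_objective.

(** * Moments of the sampling noise along a run *)

Section sampled_rounds.
Context {R : realType} {n m d : nat}.
Variables (Xi : set 'rV[R]_m) (X : set 'rV[R]_d).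
Variables (N : 'I_n -> nat) (data : forall i, 'I_(N i) -> 'rV[R]_m).
Variables (loss : 'I_n -> 'rV[R]_d -> 'rV[R]_m -> R) (B L : R).
Hypotheses (X_closed : closed X) (N_gt0 : forall i, (0 < N i)%N).
Hypothesis data_Xi : forall (i : 'I_n) (k : 'I_(N i)), Xi (data k).
Hypothesis loss_bounded : forall i u v, X u -> Xi v -> `|loss i u v| <= B.
Hypothesis loss_lipschitz : forall i u v c, X u -> X v -> Xi c ->
  `|loss i u c - loss i v c| <= L * enorm (u - v).
Context {disp : measure_display} {Omega : measurableType disp}.
Variable P : probability Omega R.
Variables (x : nat -> Omega -> 'rV[R]_d) (alpha : nat -> Omega -> 'rV[R]_n).
Variables (zeta z : 'I_n -> nat -> Omega -> 'rV[R]_m) (T : nat).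
Hypothesis xX : forall t, (1 <= t <= T)%N -> forall w, X (x t w).
Hypothesis alpha_simplex :
  forall t, (1 <= t <= T)%N -> forall w, simplex n (alpha t w).
Hypothesis run_measurable : forall t, (1 <= t <= T)%N ->
    [/\ borel_measurable (x t), borel_measurable (alpha t),
        forall i, borel_measurable (zeta i t) &
        forall i, borel_measurable (z i t)].
Hypothesis run_sampling : forall t, (1 <= t <= T)%N -> forall i A C,
    history x alpha zeta z t A -> borel m C ->
    (P (A `&` zeta i t @^-1` C) = P A * (empirical (@data i) C)%:E)%E.

Let S t := history x alpha zeta z t.

Lemma history_measurable t : (t <= T)%N -> S t `<=` measurable.
Proof.
move=> tT; apply: smallest_sub; first exact: sigma_algebra_measurable.
have rT s : (1 <= s <= t)%N -> (1 <= s <= T)%N.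
  by move=> /andP[-> /leq_trans]; apply.
have ltW_range s : (1 <= s < t)%N -> (1 <= s <= t)%N.
  by move=> /andP[-> /ltnW].
move=> A /= [[s [C [st bC ->]]]|[s [C [st bC ->]]]|[i [s [C [st bC ->]]]]|
  [i [s [C [st bC ->]]]]].
- by have [+ _ _ _] := run_measurable (rT _ st); apply.
- by have [_ + _ _] := run_measurable (rT _ st); apply.
- by have [_ _ + _] := run_measurable (rT _ (ltW_range _ st)); apply.
- by have [_ _ _] := run_measurable (rT _ (ltW_range _ st)); apply.
Qed.

Lemma history_x s t C : (1 <= s <= t)%N -> borel d C ->
  <<s S t >> (x s @^-1` C).
Proof.
(* Two generations are crossed: [history] is generated already, and the outer bracket generates from
   it again. *)
move=> st bC; do 2 apply: sub_sigma_algebra.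
by apply: Or41; exists s, C.
Qed.

Lemma history_alpha s t C : (1 <= s <= t)%N -> borel n C ->
  <<s S t >> (alpha s @^-1` C).
Proof.
move=> st bC; do 2 apply: sub_sigma_algebra.
by apply: Or42; exists s, C.
Qed.

Lemma history_zeta i s t C : (1 <= s < t)%N -> borel m C ->
  <<s S t >> (zeta i s @^-1` C).
Proof.
move=> st bC; do 2 apply: sub_sigma_algebra.
by apply: Or43; exists i, s, C.
Qed.

Let hx i t k w := loss i (x t w) (data (i := i) k).

(** With the data point fixed, this is a Lipschitz function of the iterate alone. *)
Lemma hx_measurable i s t (k : 'I_(N i)) : (1 <= s <= t)%N -> (t <= T)%N ->
  bounded_measurable (hx s k : g_sigma_algebraType (S t) -> R).
Proof.
move=> /andP[s1 st] tT; have sT : (1 <= s <= T)%N by rewrite s1 (leq_trans st).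
apply: (@bounded_measurable_lipschitz_comp _ _ _ (g_sigma_algebraType (S t))
  X (x s) (fun u => loss i u (data k)) L B) => //.
- exact: xX.
- by move=> u v Xu Xv; apply: loss_lipschitz.
- by move=> w; apply: loss_bounded => //; exact: xX.
- by move=> C bC; apply: history_x => //; rewrite s1.
Qed.

Lemma alpha_measurable i t : (1 <= t <= T)%N ->
  bounded_measurable ((fun w => alpha t w 0 i) : g_sigma_algebraType (S t) -> R).
Proof.
move=> tT.
apply: (@bounded_measurable_lipschitz_comp _ _ _ (g_sigma_algebraType (S t))
  setT (alpha t) (fun u => u 0 i) 1 1) => //.
- by move=> u v _ _; have := coord_le_enorm (u - v) i; rewrite !mxE mul1r.
- move=> w; have [a0 a1] := alpha_simplex tT w.
  by rewrite ger0_norm// -a1 (bigD1 i)//= lerDl sumr_ge0.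
- move=> C bC; apply: history_alpha => //.
  by have /andP[-> _] := tT; rewrite leqnn.
Qed.

Definition round_noise i t := noise (@data i) (zeta i t) (hx t).

(** The strict inequality matters: the noise of round s involves its draw, which enters the history
    only from round s + 1 on. *)
Lemma round_noise_measurable i s t : (1 <= s < t)%N -> (t <= T)%N ->
  bounded_measurable (round_noise i s : g_sigma_algebraType (S t) -> R).
Proof.
move=> /andP[s1 st] tT; apply: bounded_measurable_noise.
  by move=> C bC; apply: history_zeta => //; rewrite s1.
by move=> k; apply: hx_measurable => //; rewrite s1 ltnW.
Qed.

Let zeta_measurable i t : (1 <= t <= T)%N -> borel_measurable (zeta i t).
Proof. by move=> /run_measurable[]. Qed.

Let hist_sub t : (1 <= t <= T)%N -> S t `<=` measurable.
Proof. by move=> /andP[_]; exact: history_measurable. Qed.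

Lemma round_noise_random_variable i t : (1 <= t <= T)%N ->
  bounded_measurable (round_noise i t).
Proof.
move=> tT; apply: bounded_measurable_noise; first exact: zeta_measurable.
move=> k; apply: (bounded_measurable_sub (hist_sub tT)); apply: hx_measurable.
  by have /andP[-> _] := tT; rewrite leqnn.
by have /andP[] := tT.
Qed.

Lemma sampling_history i t A C : (1 <= t <= T)%N -> <<s S t >> A -> borel m C ->
  (P (A `&` zeta i t @^-1` C) = P A * (empirical (@data i) C)%:E)%E.
Proof.
move=> tT SA; apply: run_sampling => //.
by apply: smallest_sub SA => //; exact: smallest_sigma_algebra.
Qed.

(** The martingale difference property, stated as orthogonality to bounded history-measurable
    factors instead of through conditional expectation. *)
Lemma mean_history_noise i t (g : Omega -> R) (h : 'I_(N i) -> Omega -> R) :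
  (1 <= t <= T)%N ->
  bounded_measurable (g : g_sigma_algebraType (S t) -> R) ->
  (forall k, bounded_measurable (h k : g_sigma_algebraType (S t) -> R)) ->
  mean P (fun w => g w * noise (@data i) (zeta i t) h w) = 0.
Proof.
move=> tT bg bh.
rewrite (_ : (fun _ => _) = noise (@data i) (zeta i t) (fun k w => g w * h k w)).
  apply: (mean_noise (hist_sub tT)) => //.
  - exact: zeta_measurable.
  - by move=> A C SA bC; exact: sampling_history.
  - by move=> k; apply: (@bounded_measurableM _ _ (g_sigma_algebraType (S t))).
by apply/funext => w; rewrite noiseM.
Qed.

Lemma round_noise_bounded i t w :
  (1 <= t <= T)%N -> `|round_noise i t w| <= 2 * B.
Proof.
move=> tT; apply: noise_bounded => //; first by move=> j k jk; rewrite /hx jk.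
by move=> k; apply: loss_bounded => //; exact: xX.
Qed.

Lemma round_noiseE i t w : range (@data i) (zeta i t w) ->
  round_noise i t w =
  loss i (x t w) (zeta i t w) - empirical_mean (@data i) (loss i (x t w)).
Proof. exact: noiseE. Qed.

Lemma mean_sqr_sum_noise i :
  mean P (fun w => (\sum_(1 <= t < T.+1) round_noise i t w) ^+ 2) <=
  T%:R * (2 * B) ^+ 2.
Proof.
suff H s : (s <= T)%N ->
    mean P (fun w => (\sum_(1 <= t < s.+1) round_noise i t w) ^+ 2) <=
    s%:R * (2 * B) ^+ 2 by exact: H.
elim: s => [_|s ih sT].
  rewrite mul0r -[leRHS](mean_cst P 0) le_eqVlt; apply/orP; left; apply/eqP.
  by congr (mean P _); apply/funext => w; rewrite big_nil expr0n.
have sT' : (1 <= s.+1 <= T)%N by [].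
pose V w := \sum_(1 <= t < s.+1) round_noise i t w.
have bV : bounded_measurable (V : g_sigma_algebraType (S s.+1) -> R).
  by apply: bounded_measurable_sum_nat => t tr; exact: round_noise_measurable.
have bV' : bounded_measurable V := bounded_measurable_sub (hist_sub sT') bV.
have bn := round_noise_random_variable i sT'.
have bVn : bounded_measurable (fun w => V w * round_noise i s.+1 w).
  exact: bounded_measurableM.
rewrite (_ : (fun _ => _) = (fun w => (V w * V w
    + 2 * (V w * round_noise i s.+1 w))
    + round_noise i s.+1 w * round_noise i s.+1 w)); last first.
  by apply/funext => w; rewrite big_nat_recr//= -/(V w); ring.
rewrite meanD; last 2 first.
- apply: bounded_measurableD; first exact: bounded_measurableM.
  by apply: bounded_measurableM => //; exact: bounded_measurable_cst.
- exact: bounded_measurableM.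
rewrite meanD; last 2 first.
- exact: bounded_measurableM.
- by apply: bounded_measurableM => //; exact: bounded_measurable_cst.
(* The cross term vanishes because the partial sum [V] is known before round s + 1. *)
rewrite meanZ// (mean_history_noise sT' bV); last first.
  by move=> k; apply: hx_measurable => //=; rewrite leqnn.
rewrite mulr0 addr0 -natr1 mulrDl mul1r lerD//.
  by rewrite (le_trans _ (ih (ltnW sT))).
rewrite -[leRHS](mean_cst P); apply: le_mean => [||w].
- exact: bounded_measurableM.
- exact: bounded_measurable_cst.
rewrite -expr2 -real_normK ?num_real// lerXn2r ?nnegrE//.
  by rewrite (le_trans _ (round_noise_bounded i w sT')).
exact: round_noise_bounded.
Qed.

Definition comparator_noise y i t :=
  noise (@data i) (zeta i t) (fun k _ => loss i y (data k)).

Lemma comparator_noiseE y i t w : range (@data i) (zeta i t w) ->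
  comparator_noise y i t w =
  loss i y (zeta i t w) - empirical_mean (@data i) (loss i y).
Proof. exact: noiseE. Qed.

Lemma comparator_noise_random_variable y i t : (1 <= t <= T)%N ->
  bounded_measurable (comparator_noise y i t).
Proof.
move=> tT; apply: bounded_measurable_noise; first exact: zeta_measurable.
by move=> k; exact: bounded_measurable_cst.
Qed.

Lemma alpha_random_variable i t : (1 <= t <= T)%N ->
  bounded_measurable (fun w => alpha t w 0 i).
Proof.
move=> tT; apply: (bounded_measurable_sub (hist_sub tT)).
exact: alpha_measurable.
Qed.

Lemma mean_comparator_noise y i t : (1 <= t <= T)%N ->
  mean P (fun w => alpha t w 0 i * comparator_noise y i t w) = 0.
Proof.
move=> tT; apply: mean_history_noise => //; first exact: alpha_measurable.
by move=> k; exact: bounded_measurable_cst.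
Qed.

End sampled_rounds.

(** * The convergence rate *)

Theorem theorem7 (R : realType) (n m d : nat)
  (Xi : set 'rV[R]_m) (X : set 'rV[R]_d)
  (ell : 'rV[R]_d -> 'rV[R]_m -> R) (p : R) (rho : 'I_n -> R)
  (N : 'I_n -> nat) (data : forall i : 'I_n, 'I_(N i) -> 'rV[R]_m)
  (B1 B2 Lxxi Lcxi : R)
  (Xi_convex : convex_set Xi) (Xi_compact : compact Xi)
  (X_convex : convex_set X) (X_compact : compact X)
  (ell_continuous : {within X `*` Xi, continuous (fun u => ell u.1 u.2)})
  (p_ge1 : 1 <= p) (rho_gt0 : forall i : 'I_n, 0 < rho i)
  (N_gt0 : forall i : 'I_n, (0 < N i)%N)
  (data_Xi : forall (i : 'I_n) (k : 'I_(N i)), Xi (data i k))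
  (ell_differentiable : forall x xi, X x -> Xi xi ->
    differentiable_in (setT `*` Xi) (fun u => ell u.1 u.2) (x, xi))
  (ell_convex : forall xi, Xi xi -> convex_function X (fun x => ell x xi))
  (ell_bounded : forall x xi, X x -> Xi xi -> `|ell x xi| <= B1)
  (grad_bounded : forall x xi, X x -> Xi xi -> enorm (grad_x ell x xi) <= B2)
  (grad_lipschitz : forall x, X x -> elipschitz Lxxi Xi (grad_x ell x))
  (cost_continuous :
    {within Xi `*` Xi, continuous (fun u => transport_cost p u.1 u.2)})
  (phi_lipschitz : forall (i : 'I_n) x zeta, X x -> Xi zeta ->
    elipschitz_real Lcxi Xi (phi ell p rho i x zeta)) :
  exists C : R,
    forall (T : nat) (eps : R), (0 < T)%N -> 0 <= eps ->
    forall (x1 : 'rV[R]_d) (alpha1 : 'rV[R]_n), X x1 -> simplex n alpha1 ->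
    forall (disp : measure_display) (Omega : measurableType disp)
      (P : probability Omega R)
      (x : nat -> Omega -> 'rV[R]_d) (alpha : nat -> Omega -> 'rV[R]_n)
      (zeta z : 'I_n -> nat -> Omega -> 'rV[R]_m),
    bidro_fl Xi X ell p rho data P x alpha zeta z
      T (Num.sqrt T%:R)^-1 (Num.sqrt T%:R)^-1 eps x1 alpha1 ->
    (`| 'E_P[fun w => gap Xi X ell p rho data (average_iterate x T w)] |
      <= (C * ((Num.sqrt T%:R)^-1 + eps))%:E)%E.
Proof.
have [DXi DXi0 Xi_diam] := compact_ediam Xi_compact.
have [DX DX0 X_diam] := compact_ediam X_compact.
pose B := B1 + `|Lcxi| * DXi.
(* [K1] collects the two regrets, [K2] the inner inaccuracy and [K3] the squared noise sums; the
   extra 1 below pays for the near-minimizer [y]. *)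
pose K1 := n%:R + n%:R * B ^+ 2 + (DX ^+ 2 + B2 ^+ 2).
pose K2 := n%:R * `|Lcxi| + `|Lxxi| * DX.
pose K3 : R := n%:R * (2^-1 * ((2 * B) ^+ 2 + 1)).
exists (1 + K1 + K2 + K3) => T eps T0 eps0 x1 alpha1 Xx1 salpha1.
move=> disp Omega P x alpha zeta z.
case=> xE alphaE mrun srun inner xstep alphastep.
(* An empty sum cannot be 1, so a point of the simplex forces at least one client. *)
have n0 : (0 < n)%N.
  case: (posnP n) => // n0; have [_] := salpha1.
  rewrite big1 => [/eqP|i _]; first by rewrite eq_sym oner_eq0.
  by have := ltn_ord i; rewrite {2}n0.
have X_closed : closed X by apply: compact_closed => //; exact: norm_hausdorff.
have xX t : (1 <= t <= T)%N -> forall w, X (x t w).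
  case: t => // -[_ w|t /andP[_ tT] w]; first by rewrite xE.
  by have [] := xstep t.+1 (ltnW tT) w.
have alphaS t : (1 <= t <= T)%N -> forall w, simplex n (alpha t w).
  case: t => // -[_ w|t /andP[_ tT] w]; first by rewrite alphaE.
  by have [] := alphastep t.+1 (ltnW tT) w.
pose s : R := Num.sqrt T%:R.
have s0 : 0 < s by rewrite sqrtr_gt0 ltr0n.
have sT : s ^+ 2 = T%:R by rewrite sqr_sqrtr.
pose loss := robust_loss Xi ell p rho.
pose gp := gap Xi X ell p rho data.
(* The comparator is deterministic, which gives its weighted noise mean zero; it is optimal up to
   1/sqrt T. *)
have [y Xy gy] : exists2 y, X y & forall u, gp u <=
    worst_case Xi ell p rho data u - worst_case Xi ell p rho data y + s^-1.
  apply: (gap_near_minimizer Xi_compact p_ge1 N_gt0 data_Xi ell_bounded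
    phi_lipschitz Xi_diam n0); first by exists x1.
  by rewrite invr_gt0.
have lossB i u v : X u -> Xi v -> `|loss i u v| <= B.
  exact: (robust_loss_bounded Xi_compact p_ge1 ell_bounded phi_lipschitz Xi_diam).
have lossL i u v c : X u -> X v -> Xi c ->
    `|loss i u c - loss i v c| <= B2 * enorm (u - v).
  exact: (robust_loss_lipschitz Xi_compact X_convex ell_differentiable
    ell_convex grad_bounded phi_lipschitz).
pose avg := average_iterate x T.
have Xavg w : X (avg w).
  by apply: convex_set_average => // t tT; exact: xX.
pose rn := round_noise data loss x zeta.
pose cn := comparator_noise data loss zeta y.
have brn i t : (1 <= t <= T)%N -> bounded_measurable (rn i t).
  exact: (round_noise_random_variable X_closed data_Xi lossB lossL xX mrun).
have bcn i t : (1 <= t <= T)%N -> bounded_measurable (cn i t).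
  exact: (comparator_noise_random_variable data loss mrun).
have balpha i t : (1 <= t <= T)%N -> bounded_measurable (fun w => alpha t w 0 i).
  exact: (alpha_random_variable alphaS mrun).
pose Q w : R := \sum_i 2^-1 * (s^-1 * (\sum_(1 <= t < T.+1) rn i t w) ^+ 2 + s).
pose W w := \sum_(1 <= t < T.+1) \sum_i alpha t w 0 i * cn i t w.
pose k := s * K1 + T%:R * (n%:R * (`|Lcxi| * (eps + s^-1)) +
  `|Lxxi| * (eps + s^-1) * DX).
pose U w := s^-1 + T%:R^-1 * (k + (Q w + W w)).
pose D i t := zeta i t @^-1` (~` range (@data i)).
(* Counts the draws outside their datasets. Such draws have probability zero but are not excluded
   pointwise. *)
pose bad w : R := \sum_(1 <= t < T.+1) \sum_i \1_(D i t) w.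
have mD i t : (1 <= t <= T)%N -> measurable (D i t).
  move=> tT; have [_ _ + _] := mrun t tT; apply.
  apply: sigma_algebraC; apply: borel_closed.
  apply: compact_closed; first exact: norm_hausdorff.
  by apply: finite_compact; exact: finite_image.
have PD i t : (1 <= t <= T)%N -> P (D i t) = 0%E.
  move=> tT; apply: (@data_ae _ _ _ _ _ _ _ _ (history x alpha zeta z t)).
  by move=> A C; exact: (sampling_history srun).
have bS i : bounded_measurable (fun w => \sum_(1 <= t < T.+1) rn i t w).
  by apply: bounded_measurable_sum_nat => t; rewrite ltnS; exact: brn.
have bSS i : bounded_measurable (fun w => (\sum_(1 <= t < T.+1) rn i t w) ^+ 2).
  rewrite (_ : (fun _ => _) = (fun w => (\sum_(1 <= t < T.+1) rn i t w) *
    (\sum_(1 <= t < T.+1) rn i t w))); first exact: bounded_measurableM.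
  by apply/funext => w; rewrite expr2.
have bc c : bounded_measurable ((fun=> c) : Omega -> R).
  exact: bounded_measurable_cst.
have bQi i : bounded_measurable
    (fun w => 2^-1 * (s^-1 * (\sum_(1 <= t < T.+1) rn i t w) ^+ 2 + s)).
  apply: bounded_measurableM => //; apply: bounded_measurableD => //.
  exact: bounded_measurableM.
have bQ : bounded_measurable Q by exact: bounded_measurable_sum.
have bWt t : (1 <= t < T.+1)%N ->
    bounded_measurable (fun w => \sum_i alpha t w 0 i * cn i t w).
  rewrite ltnS => tT; apply: bounded_measurable_sum => i _.
  by apply: bounded_measurableM; [exact: balpha|exact: bcn].
have bW : bounded_measurable W by exact: bounded_measurable_sum_nat.
have bQW : bounded_measurable (fun w => Q w + W w).
  exact: bounded_measurableD.
have bkQW : bounded_measurable (fun w => k + (Q w + W w)).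
  exact: bounded_measurableD.
have bU : bounded_measurable U.
  by apply: bounded_measurableD => //; exact: bounded_measurableM.
have bDt t : (1 <= t < T.+1)%N ->
    bounded_measurable (fun w => \sum_i \1_(D i t) w : R).
  rewrite ltnS => tT; apply: bounded_measurable_sum => i _.
  by apply: bounded_measurable_indic; exact: mD.
have bbad : bounded_measurable bad by exact: bounded_measurable_sum_nat.
have Ebad : mean P bad = 0.
  rewrite mean_sum_nat// big_nat big1// => t; rewrite ltnS => tT.
  rewrite mean_sum => [|i _]; last exact/bounded_measurable_indic/mD.
  rewrite big1// => i _.
  by rewrite mean_indic; [rewrite (PD i t tT)|exact: mD].
have EW : mean P W = 0.
  rewrite mean_sum_nat// big_nat big1// => t; rewrite ltnS => tT.
  rewrite mean_sum => [|i _]; last first.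
    by apply: bounded_measurableM; [exact: balpha|exact: bcn].
  by rewrite big1// => i _; exact: (mean_comparator_noise loss alphaS mrun srun).
have EQ : mean P Q <= s * K3.
  (* Per client, the mean of S^2 / s is at most T (2B)^2 / s = s (2B)^2. *)
  have -> : s * K3 = \sum_(i < n) s * (2^-1 * ((2 * B) ^+ 2 + 1)).
    by rewrite sumr_const card_ord /K3 mulrCA -[RHS]mulr_natl.
  rewrite mean_sum//.
  apply: ler_sum => i _.
  rewrite meanZ; last first.
    by apply: bounded_measurableD => //; exact: bounded_measurableM.
  rewrite [leRHS]mulrCA ler_wpM2l ?invr_ge0//.
  rewrite meanD//; last exact: bounded_measurableM.
  rewrite meanZ// mean_cst mulrDr mulr1 lerD2r ler_pdivrMl// mulrA -expr2 sT.
  exact: (mean_sqr_sum_noise X_closed N_gt0 data_Xi lossB lossL xX mrun srun).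
have EU : mean P U <= s^-1 + T%:R^-1 * (k + s * K3).
  rewrite meanD//; last exact: bounded_measurableM.
  rewrite mean_cst lerD2l meanZ// ler_wpM2l ?invr_ge0//.
  by rewrite meanD// mean_cst lerD2l meanD// EW addr0.
have bad_ge0 w : 0 <= bad w by apply: sumr_ge0 => t _; exact: sumr_ge0.
have [M MU] := bU.2.
(* The multiple of [bad] makes the bound hold at every outcome: where some draw is off its dataset,
   [bad] is at least 1 and its coefficient covers the crude gap bound and the least value of [U].
   Its mean is zero. *)
have gapU w : gp (avg w) <= U w + (2 * `|B| + `|M|) * bad w.
  have [good|] := pselect (forall i t, (1 <= t <= T)%N ->
      range (@data i) (zeta i t w)).
    have -> : bad w = 0.
      rewrite /bad big_nat big1// => t; rewrite ltnS => tT.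
      rewrite big1// => i _; rewrite indicE memNset// => nr.
      exact: nr (good i t tT).
    rewrite mulr0 addr0.
    have zetaXi i t : (1 <= t <= T)%N -> Xi (zeta i t w).
      by move=> /(good i)[j _ <-].
    have := gap_average_le Xi_compact X_convex p_ge1 N_gt0 data_Xi
      ell_differentiable ell_convex ell_bounded grad_bounded grad_lipschitz
      phi_lipschitz Xi_diam X_diam T0 (fun t tT => xX t tT w)
      (fun t tT => alphaS t tT w) zetaXi
      (fun i t tT => (inner t tT i w).1) (fun i t tT => (inner t tT i w).2)
      (fun t tT => xstep t tT w) (fun t tT => alphastep t tT w) n0 Xy gy.
    rewrite -/s -/gp -/(avg w) -/B => /le_trans; apply.
    rewrite /U lerD2l ler_pM2l ?invr_gt0 ?ltr0n// lerD2l lerD//.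
      rewrite le_eqVlt; apply/orP; left; apply/eqP; apply: eq_bigr => i _.
      congr (_ * (_ * _ ^+ 2 + _)); rewrite !big_nat; apply: eq_bigr => t.
      by rewrite ltnS => tT; rewrite /rn round_noiseE//; exact: good.
    rewrite le_eqVlt; apply/orP; left; apply/eqP.
    rewrite /W !big_nat; apply: eq_bigr => t; rewrite ltnS => tT.
    apply: eq_bigr => i _; congr (_ * _).
    by rewrite /cn comparator_noiseE//; exact: good.
  move=> /existsNP[i /existsNP[t /not_implyP[tT zD]]].
  have bad1 : 1 <= bad w.
    have tT' : t \in index_iota 1 T.+1 by rewrite mem_index_iota ltnS.
    rewrite /bad (big_rem t)//= (bigD1 i)//= indicE mem_set// -addrA lerDl.
    by rewrite addr_ge0// sumr_ge0// => u _; exact: sumr_ge0.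
  have gB : gp (avg w) <= 2 * B.
    exact: (gap_le_bound Xi_compact p_ge1 N_gt0 data_Xi ell_bounded
      phi_lipschitz Xi_diam n0).
  have := MU w; rewrite ler_norml => /andP[MU' _].
  have : 2 * `|B| + `|M| <= (2 * `|B| + `|M|) * bad w.
    by rewrite ler_peMr// addr_ge0// mulr_ge0.
  have := ler_norm B; have := ler_norm M; lra.
have gap01 w : 0 <= gp (avg w) <= U w + (2 * `|B| + `|M|) * bad w.
  rewrite gapU andbT.
  exact: (gap_ge0 Xi_compact p_ge1 N_gt0 data_Xi ell_bounded phi_lipschitz
    Xi_diam n0).
have bMbad : bounded_measurable (fun w => (2 * `|B| + `|M|) * bad w).
  exact: bounded_measurableM.
have /andP[E0 EUb] :=
  expectation_le_bounded P gap01 (bounded_measurableD bU bMbad).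
rewrite gee0_abs//; apply: (le_trans EUb); rewrite lee_fin.
rewrite meanD// meanZ// Ebad mulr0 addr0 (le_trans EU)// -/s.
have Ts : T%:R^-1 * s = s^-1 by rewrite -sT; field; lra.
have TT : T%:R^-1 * T%:R = 1 :> R by rewrite mulVf// pnatr_eq0 -lt0n.
(* Since s / T = 1/s, regrets and noise contribute order 1/sqrt T, while the inner errors are
   averaged over T rounds and stay of order eps + 1/sqrt T. *)
have -> : T%:R^-1 * (k + s * K3) = (T%:R^-1 * s) * (K1 + K3) +
    (T%:R^-1 * T%:R) * (n%:R * (`|Lcxi| * (eps + s^-1)) +
    `|Lxxi| * (eps + s^-1) * DX) by rewrite /k; ring.
rewrite Ts TT mul1r.
have : 0 <= (1 + K1 + K3) * eps.
  rewrite mulr_ge0//.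
  have nB : 0 <= n%:R * B ^+ 2 by rewrite mulr_ge0 ?sqr_ge0.
  have K30 : 0 <= K3.
    by rewrite mulr_ge0// mulr_ge0 ?invr_ge0// addr_ge0 ?sqr_ge0.
  have := sqr_ge0 DX; have := sqr_ge0 B2; have := ler0n R n.
  by rewrite /K1; lra.
rewrite /K2; lra.
Qed.
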